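(* In what follows $S$ ranges over the diagonal $n\times n$ matrices with positive real diagonal entries, and $U$ over the diagonal $n\times n$ matrices with complex diagonal entries of modulus $1$. (1) For any $n\ge 1$, any $B\in\mathcal{M}_n(\mathbb{C})$ and any such $S$, $U$, $$\rho(UB)=\rho(SUBS^{-1})\le \|SUBS^{-1}\|=\|SBS^{-1}\|.$$ In particular, for any $B\in\mathcal{M}_n(\mathbb{C})$, $$\inf_{S,U}\Big(\|SUBS^{-1}\|-\rho(SUBS^{-1})\Big)=\inf_S\|SBS^{-1}\|-\max_U\rho(UB).$$ (2) If $n\le 3$ and $B\in\mathcal{M}_n(\mathbb{C})$, or if $n\le 5$ and $B\in\mathcal{M}_n(\mathbb{R})$, then $$\inf_{S,U}\Big(\|SUBS^{-1}\|-\rho(SUBS^{-1})\Big)=0.$$ (3) For any $n\ge 4$, there exists $B\in\mathcal{M}_n(\mathbb{C})$ such that $$\inf_S\|SBS^{-1}\|>\max_U\rho(UB).$$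
   Context: $\mathcal{M}_n(\mathbb{K})$ denotes the $n\times n$ matrices with entries in $\mathbb{K}$. For a complex $n\times n$ matrix $M$, $\rho(M)$ is its spectral radius, i.e. the maximum modulus of its complex eigenvalues (complex spectrum is used also when $M$ is real), and $\|M\|=\max_{|u|=1}|Mu|$ is the operator norm induced by the Euclidean (Hermitian) norm on $\mathbb{C}^n$. Note that even when $B$ is real, $U$ is allowed to be complex. *)

(* Defs.v *)
From HB Require Import structures.
From mathcomp Require Import all_boot all_order all_algebra.
From mathcomp Require Import all_classical all_reals.
From mathcomp Require Export complex.

Set Implicit Arguments.
Unset Strict Implicit.
Unset Printing Implicit Defensive.

Import Order.TTheory GRing.Theory Num.Theory.
Export ComplexField.Normc (normc).

Local Open Scope classical_set_scope.
Local Open Scope ring_scope.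

(* [normc z : R] is the modulus of [z : R[i]]; the norm [`|z|] of the library
   is the same number, but seen as an element of [R[i]]. *)

(* [eigenvalue] uses row eigenvectors; the spectrum is the same as with column
   eigenvectors. For 0 < n the spectrum is finite and nonempty, so that the
   supremum is a maximum. *)
Definition spectral_radius (R : realType) (n : nat) (M : 'M[R[i]]_n) : R :=
  sup [set normc a | a in [set a : R[i] | eigenvalue M a]].

Definition hermitian_norm (R : realType) (n : nat) (u : 'cV[R[i]]_n) : R :=
  Num.sqrt (\sum_(i < n) normc (u i ord0) ^+ 2).

(* For 0 < n the unit sphere is compact and nonempty, so that the supremum is
   a maximum. *)
Definition opnorm (R : realType) (n : nat) (M : 'M[R[i]]_n) : R :=
  sup [set hermitian_norm (M *m u) |
        u in [set u : 'cV[R[i]]_n | hermitian_norm u = 1]].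

(* In the order of [R[i]], [0 < z] means that z is real and positive. *)
Definition pos_diag (R : realType) (n : nat) : set 'M[R[i]]_n :=
  [set S | is_diag_mx S /\ forall i, 0 < S i i].

Definition unimod_diag (R : realType) (n : nat) : set 'M[R[i]]_n :=
  [set U | is_diag_mx U /\ forall i, normc (U i i) = 1].

Definition inf_gap (R : realType) (n : nat) (B : 'M[R[i]]_n) : R :=
  inf [set opnorm (S *m U *m B *m invmx S)
             - spectral_radius (S *m U *m B *m invmx S) |
        S in @pos_diag R n & U in @unimod_diag R n].

Definition inf_scaled_norm (R : realType) (n : nat) (B : 'M[R[i]]_n) : R :=
  inf [set opnorm (S *m B *m invmx S) | S in @pos_diag R n].

(* [is_max A m]: m is the maximum of A, in particular it is attained. *)
Definition is_max (R : realType) (A : set R) (m : R) : Prop :=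
  A m /\ ubound A m.

Definition rotated_radii (R : realType) (n : nat) (B : 'M[R[i]]_n) : set R :=
  [set spectral_radius (U *m B) | U in @unimod_diag R n].

(* Main.v *)
Require Import Defs.
From mathcomp Require Import all_boot all_order all_algebra.
From mathcomp Require Import all_classical all_reals.
From mathcomp Require Import topology normedtype derive ring lra.

(* Write N = inf_S |S B S^-1| and m = max_U rho (U B); the heart of the matter is
   N = m in low dimension.

   The determinant of l - Delta B is affine in each diagonal entry of Delta, so
   that the largest |l| over the polydisc |delta_k| <= 1 is attained on the
   torus. Hence m >= b as soon as some v <> 0 satisfies |(B v)_k| >= b |v_k| for
   all k.

   By separation, b <= N gives a matrix X = L L^*, of trace 1, such that
   (B X B^* )_kk >= b^2 X_kk for all k. These are n real linear conditions on X. If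
   X = Y Y^* where Y has p columns, the Hermitian (resp. real symmetric)
   directions D of size p form a real space of dimension p^2 (resp. p (p + 1) / 2),
   so that one of them leaves the n quantities unchanged when n < p^2 (resp.
   n < p (p + 1) / 2); moving Y Y^* along Y D Y^* until the psd cone is left lowers
   the number of columns. For n <= 3 this leads to one complex column; for B real
   and n <= 5, to two real columns x and y, and v = x + i y is as required.

   For (3), take B_kl = (x_k - x_l) / 4 with x = (0, 1, i, -1 - i): it maps the
   orthogonal vectors 1 and conj x to x and -1, so that N >= 1, whereas m >= 1
   would give a combination v of these two vectors with |(B v)_k| = |v_k|, which
   forces v = 0. *)

Set Implicit Arguments.
Unset Strict Implicit.
Unset Printing Implicit Defensive.

Import Order.TTheory GRing.Theory Num.Theory Num.Def.
Import numFieldNormedType.Exports.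
Local Open Scope classical_set_scope.
Local Open Scope ring_scope.
Local Open Scope complex_scope.
Local Open Scope sesquilinear_scope.

(** * Moduli, spectra and operator norms *)

(** Squared moduli are polynomial in the real and imaginary parts, so that comparisons and
    continuity need no square roots. *)
Definition nsq (R : realType) (z : R[i]) : R := complex.Re z ^+ 2 + complex.Im z ^+ 2.

Definition vnsq (R : realType) (n : nat) (u : 'cV[R[i]]_n) : R :=
  \sum_i nsq (u i ord0).

Section Modulus.
Variable R : realType.
Implicit Types z w : R[i].

Lemma nsq_ge0 z : 0 <= nsq z.
Proof. by rewrite addr_ge0 ?sqr_ge0. Qed.

Lemma normcE z : normc z = Num.sqrt (nsq z).
Proof. by case: z. Qed.

Lemma normc_sqr z : normc z ^+ 2 = nsq z.
Proof. by rewrite normcE sqr_sqrtr ?nsq_ge0. Qed.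

Lemma normc_ge0 z : 0 <= normc z.
Proof. by rewrite normcE sqrtr_ge0. Qed.

Lemma nsqM z w : nsq (z * w) = nsq z * nsq w.
Proof. by rewrite -!normc_sqr ComplexField.Normc.normcM exprMn. Qed.

Lemma nsq_eq0 z : (nsq z == 0) = (z == 0).
Proof.
apply/eqP/eqP=> [|->]; last by rewrite /nsq /= expr0n addr0.
move=> z0; apply: ComplexField.Normc.eq0_normc.
by rewrite normcE z0 sqrtr0.
Qed.

Lemma nsq_gt0 z : (0 < nsq z) = (z != 0).
Proof. by rewrite lt_def nsq_ge0 nsq_eq0 andbT. Qed.

Lemma nsq0 : nsq (0 : R[i]) = 0.
Proof. by apply/eqP; rewrite nsq_eq0. Qed.

Lemma nsqN z : nsq (- z) = nsq z.
Proof. by rewrite /nsq !raddfN /= !sqrrN. Qed.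

Lemma nsqR (x : R) : nsq (real_complex R x) = x ^+ 2.
Proof. by rewrite /nsq /= expr0n addr0. Qed.

Lemma nsqV z : nsq z^-1 = (nsq z)^-1.
Proof. by rewrite -!normc_sqr ComplexField.Normc.normcV exprVn. Qed.

Lemma mulC_conjc z : z * z^*%C = real_complex R (nsq z).
Proof. by case: z => a b; rewrite /nsq; simpc; rewrite -!expr2 [b * a]mulrC addNr. Qed.

Lemma normc_sum (I : finType) (F : I -> R[i]) :
  normc (\sum_i F i) <= \sum_i normc (F i).
Proof.
elim/big_ind2: _ => [|x y z t le_x le_z|//]; first by rewrite ComplexField.Normc.normc0.
by apply: le_trans (lerD le_x le_z); apply: le_normcD.
Qed.

End Modulus.

Section Spectrum.
Variables (R : realType) (n : nat).
Implicit Types (M S U B : 'M[R[i]]_n) (u w : 'cV[R[i]]_n) (a : R[i]).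

Lemma vnsq_ge0 u : 0 <= vnsq u.
Proof. by apply: sumr_ge0 => i _; apply: nsq_ge0. Qed.

Lemma nsq_le_vnsq u i : nsq (u i ord0) <= vnsq u.
Proof.
rewrite /vnsq (bigD1 i) //= lerDl; apply: sumr_ge0 => j _; exact: nsq_ge0.
Qed.

Lemma vnsq_eq0 u : (vnsq u == 0) = (u == 0).
Proof.
apply/eqP/eqP=> [u0|->]; last by apply: big1 => i _; rewrite mxE nsq0.
apply/colP => i; apply/eqP; rewrite mxE -nsq_eq0 eq_le nsq_ge0 andbT.
by rewrite -u0 nsq_le_vnsq.
Qed.

Lemma vnsq_gt0 u : (0 < vnsq u) = (u != 0).
Proof. by rewrite lt_def vnsq_ge0 vnsq_eq0 andbT. Qed.

Lemma vnsqZ a u : vnsq (a *: u) = nsq a * vnsq u.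
Proof. by rewrite /vnsq mulr_sumr; apply: eq_bigr => i _; rewrite mxE nsqM. Qed.

Lemma hermitian_normE u : hermitian_norm u = Num.sqrt (vnsq u).
Proof. by congr Num.sqrt; apply: eq_bigr => i _; rewrite normc_sqr. Qed.

Lemma hermitian_norm1 u : (hermitian_norm u == 1) = (vnsq u == 1).
Proof.
rewrite hermitian_normE; apply/eqP/eqP => [|->]; last by rewrite sqrtr1.
by move/(congr1 (fun x => x ^+ 2)); rewrite sqr_sqrtr ?vnsq_ge0 // expr1n.
Qed.

Lemma normc_le_sqrt_vnsq u i : normc (u i ord0) <= Num.sqrt (vnsq u).
Proof. by rewrite normcE ler_wsqrtr // nsq_le_vnsq. Qed.

(** Each |u_j| is at most |u|, so the row sums of moduli give a crude constant. Only its finiteness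
    matters: it bounds the supremum in [opnorm] and the roots of the pencils below. *)
Lemma vnsq_mulmx_bound M : exists F : R, forall u, vnsq (M *m u) <= F * vnsq u.
Proof.
exists (\sum_i (\sum_j normc (M i j)) ^+ 2) => u.
rewrite mulr_suml; apply: ler_sum => i _.
rewrite -normc_sqr -[vnsq u]sqr_sqrtr ?vnsq_ge0 // -exprMn.
rewrite ler_pXn2r ?nnegrE ?normc_ge0 //; last first.
  by rewrite mulr_ge0 ?sqrtr_ge0 // sumr_ge0 // => j _; rewrite normc_ge0.
rewrite mxE; apply: le_trans (normc_sum _) _.
rewrite mulr_suml; apply: ler_sum => j _.
rewrite ComplexField.Normc.normcM ler_wpM2l ?normc_ge0 //.
exact: normc_le_sqrt_vnsq.
Qed.

Lemma opnorm_has_ubound M :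
  has_ubound [set hermitian_norm (M *m u) | u in [set u | hermitian_norm u = 1]].
Proof.
have [F leF] := vnsq_mulmx_bound M.
exists (Num.sqrt F) => _ [u /eqP + <-]; rewrite hermitian_norm1 => /eqP u1.
by rewrite hermitian_normE ler_wsqrtr // (le_trans (leF u)) // u1 mulr1.
Qed.

Lemma opnorm_ge0 M : 0 <= opnorm M.
Proof.
rewrite /opnorm; set A := [set _ | _ in _].
(* For n = 0 the unit sphere is empty and the supremum takes its default value 0. *)
have [->|/set0P[x Ax]] := eqVneq A set0; first by rewrite sup0.
apply: le_trans (ub_le_sup (opnorm_has_ubound M) Ax).
by case: Ax => u _ <-; rewrite sqrtr_ge0.
Qed.

Lemma vnsq_mulmx_le M u : vnsq (M *m u) <= opnorm M ^+ 2 * vnsq u.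
Proof.
have [->|u0] := eqVneq u 0.
  by rewrite mulmx0 (eqP (_ : vnsq 0 == 0)) ?vnsq_eq0 ?mulr0.
have v0 : 0 < vnsq u by rewrite vnsq_gt0.
pose c := (Num.sqrt (vnsq u))^-1.
have c2 : c ^+ 2 = (vnsq u)^-1 by rewrite exprVn sqr_sqrtr ?ltW.
have : hermitian_norm (M *m (real_complex R c *: u)) <= opnorm M.
  apply: (ub_le_sup (opnorm_has_ubound M)); exists (real_complex R c *: u) => //=.
  by apply/eqP; rewrite hermitian_norm1 vnsqZ nsqR c2 mulVf // gt_eqF.
rewrite hermitian_normE -scalemxAr vnsqZ nsqR c2 => leN.
rewrite -ler_pdivrMr // mulrC -[leLHS]sqr_sqrtr ?mulr_ge0 ?invr_ge0 ?vnsq_ge0 //.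
by rewrite ler_pXn2r ?nnegrE ?sqrtr_ge0 ?opnorm_ge0.
Qed.

Lemma opnorm_le M (c : R) : 0 <= c ->
  (forall u, vnsq u = 1 -> vnsq (M *m u) <= c ^+ 2) -> opnorm M <= c.
Proof.
move=> c0 leM; rewrite /opnorm; set A := [set _ | _ in _].
have [->|/set0P A0] := eqVneq A set0; first by rewrite sup0.
apply: ge_sup A0 _ => _ [u /eqP + <-]; rewrite hermitian_norm1 => /eqP u1.
by rewrite hermitian_normE -(ger0_norm c0) -sqrtr_sqr ler_wsqrtr // leM.
Qed.

Lemma eigenvalue_det M a : eigenvalue M a = (\det (a%:M - M) == 0).
Proof.
rewrite eigenvalue_root_char /root /char_poly -horner_evalE -det_map_mx.
congr (\det _ == 0); apply/matrixP => i j; rewrite !mxE /horner_eval.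
by rewrite rmorphB rmorphMn /= /horner_eval hornerX hornerC.
Qed.

(** A determinant is invariant under transposition, which exchanges row and column eigenvectors. *)
Lemma eigenvalue_colP M a :
  reflect (exists2 u : 'cV_n, u != 0 & M *m u = a *: u) (eigenvalue M a).
Proof.
have -> : eigenvalue M a = eigenvalue M^T a.
  by rewrite !eigenvalue_det -[in LHS]det_tr linearB /= tr_scalar_mx.
apply: (iffP eigenvalueP) => [[v vM v0]|[u u0 Mu]].
  exists v^T; first by rewrite -trmx0 (inj_eq trmx_inj).
  by apply: trmx_inj; rewrite trmx_mul trmxK vM linearZ /= trmxK.
exists u^T; last by rewrite -trmx0 (inj_eq trmx_inj).
by rewrite -trmx_mul Mu linearZ.
Qed.

Lemma det0_colP M : reflect (exists2 u : 'cV_n, u != 0 & M *m u = 0) (\det M == 0).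
Proof.
have -> : (\det M == 0) = eigenvalue M 0.
  by rewrite eigenvalue_det raddf0 sub0r -scaleN1r detZ mulf_eq0 signr_eq0.
apply: (iffP (eigenvalue_colP _ _)) => -[u u0]; rewrite ?scale0r => Mu; exists u => //.
by rewrite scale0r.
Qed.

Lemma eigenvalue_opnorm M a : eigenvalue M a -> normc a <= opnorm M.
Proof.
case/eigenvalue_colP=> u u0 Mu; have := vnsq_mulmx_le M u.
rewrite Mu vnsqZ ler_pM2r ?vnsq_gt0 // -(normc_sqr a).
by rewrite ler_pXn2r ?nnegrE ?normc_ge0 ?opnorm_ge0.
Qed.

Lemma spectral_radius_ub M a : eigenvalue M a -> normc a <= spectral_radius M.
Proof.
move=> Ma; apply: ub_le_sup; last by exists a.
by exists (opnorm M) => _ [b Mb <-]; apply: eigenvalue_opnorm.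
Qed.

Lemma spectral_radius_ge0 M : 0 <= spectral_radius M.
Proof.
rewrite /spectral_radius; set A := [set _ | _ in _].
have [->|/set0P[x [a Ma _]]] := eqVneq A set0; first by rewrite sup0.
exact: le_trans (normc_ge0 a) (spectral_radius_ub Ma).
Qed.

(** The characteristic polynomial splits; for 0 < n its finite list of roots is nonempty and has an
    element of largest modulus. *)
Lemma spectral_radius_attained M : (0 < n)%N ->
  exists2 a, eigenvalue M a & normc a = spectral_radius M.
Proof.
move=> n0; have [rs cE] := closed_field_poly_normal (char_poly M).
have rsP a : eigenvalue M a = (a \in rs).
  by rewrite eigenvalue_root_char cE (monicP (char_poly_monic M)) scale1r root_prod_XsubC.
have s0 : (0 < size rs)%N.
  have [a] := eigenvalue_closed M n0.
  by rewrite rsP; case: (rs).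
pose i := [arg max_(i > Ordinal s0) normc rs`_i]%O.
exists rs`_i; first by rewrite rsP mem_nth.
apply/eqP; rewrite eq_le spectral_radius_ub ?rsP ?mem_nth //=.
apply: ge_sup; first by exists (normc rs`_i), rs`_i; rewrite //= rsP mem_nth.
move=> _ [b /= + <-]; rewrite rsP => /(nthP 0)[j lj <-].
rewrite /i; case: arg_maxP => //= k _ /(_ (Ordinal lj)); exact.
Qed.

Lemma spectral_radius_le_opnorm M : (0 < n)%N -> spectral_radius M <= opnorm M.
Proof. by case/(spectral_radius_attained M) => a Ma <-; apply: eigenvalue_opnorm. Qed.

Lemma pos_diag_unit S : pos_diag S -> S \in unitmx.
Proof.
case=> /diag_mxP[d ->] Sp; rewrite unitmxE det_diag unitfE.
by apply/prodf_neq0 => i _; have := Sp i; rewrite !mxE eqxx mulr1n => /lt0r_neq0.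
Qed.

Lemma eigenvalue_conj S M a : S \in unitmx ->
  eigenvalue (S *m M *m invmx S) a = eigenvalue M a.
Proof.
move=> Su; rewrite !eigenvalue_det.
have E : (a%:M - S *m M *m invmx S) *m S = S *m (a%:M - M).
  by rewrite mulmxBl mulmxBr mulmxKV // scalar_mxC.
have dS : \det S != 0 by rewrite -unitfE -unitmxE.
move/(congr1 determinant): E; rewrite !det_mulmx mulrC => /(mulfI dS) -> //.
Qed.

Lemma spectral_radius_conj S M : S \in unitmx ->
  spectral_radius (S *m M *m invmx S) = spectral_radius M.
Proof.
move=> Su; rewrite /spectral_radius.
suff -> : eigenvalue (S *m M *m invmx S) = eigenvalue M by [].
by apply/funext => a; rewrite eigenvalue_conj.
Qed.

Lemma is_diag_mulmxE D u i : is_diag_mx D -> (D *m u) i ord0 = D i i * u i ord0.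
Proof. by case/diag_mxP => d ->; rewrite mul_diag_mx !mxE eqxx mulr1n. Qed.

Lemma vnsq_unimod U u : unimod_diag U -> vnsq (U *m u) = vnsq u.
Proof.
case=> Ud U1; apply: eq_bigr => i _.
by rewrite is_diag_mulmxE // nsqM -normc_sqr U1 expr1n mul1r.
Qed.

Lemma eq_opnorm M B : (forall u, vnsq (M *m u) = vnsq (B *m u)) -> opnorm M = opnorm B.
Proof.
move=> MB; rewrite /opnorm.
have -> // : (fun u => hermitian_norm (M *m u)) = (fun u => hermitian_norm (B *m u)).
by apply/funext => u; rewrite !hermitian_normE MB.
Qed.

(** Diagonal matrices commute, so U can be moved to the far left, where it acts as an isometry. *)
Lemma opnorm_unimod S U B : pos_diag S -> unimod_diag U ->
  opnorm (S *m U *m B *m invmx S) = opnorm (S *m B *m invmx S).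
Proof.
move=> [Sd Sp] Uu; have Ud := Uu.1; apply: eq_opnorm => u.
have -> : S *m U = U *m S.
  by move/diag_mxP: Sd => [s ->]; move/diag_mxP: Ud => [v ->]; exact: diag_mxC.
by rewrite -!mulmxA vnsq_unimod.
Qed.

End Spectrum.

(** * The largest root over the polydisc *)

Section ComplexContinuity.
Variables (R : realType) (T : topologicalType).
Implicit Types f g : T -> R[i].

(** Continuity is expressed through the two real coordinates, so that only the topology of [R]
    enters. *)
Definition ccont f := continuous (fun t => complex.Re (f t)) /\
                      continuous (fun t => complex.Im (f t)).

Lemma ccont_cst (z : R[i]) : ccont (fun=> z).
Proof. by split=> t; apply: cvg_cst. Qed.

Lemma ccont_pair (a b : T -> R) : continuous a -> continuous b ->
  ccont (fun t => a t +i* b t).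
Proof. by []. Qed.

Lemma ccontD f g : ccont f -> ccont g -> ccont (fun t => f t + g t).
Proof.
move=> [f1 f2] [g1 g2]; split=> t; under eq_fun do rewrite raddfD /=.
  by apply: cvgD; [exact: f1|exact: g1].
by apply: cvgD; [exact: f2|exact: g2].
Qed.

Lemma ccontM f g : ccont f -> ccont g -> ccont (fun t => f t * g t).
Proof.
move=> [f1 f2] [g1 g2].
have -> : (fun t => f t * g t) = (fun t =>
  (complex.Re (f t) * complex.Re (g t) - complex.Im (f t) * complex.Im (g t)) +i*
  (complex.Re (f t) * complex.Im (g t) + complex.Im (f t) * complex.Re (g t))).
  by apply/funext => t; case: (f t) (g t) => a b [c d]; simpc.
split=> t /=.
  by apply: cvgB; apply: cvgM; [exact: f1|exact: g1|exact: f2|exact: g2].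
by apply: cvgD; apply: cvgM; [exact: f1|exact: g2|exact: f2|exact: g1].
Qed.

Lemma ccontN f : ccont f -> ccont (fun t => - f t).
Proof.
move=> cf; have := ccontM (ccont_cst (-1)) cf.
by congr ccont; apply/funext => t; rewrite mulN1r.
Qed.

Lemma ccont_sum (I : Type) (r : seq I) (P : pred I) (F : I -> T -> R[i]) :
  (forall i, ccont (F i)) -> ccont (fun t => \sum_(i <- r | P i) F i t).
Proof.
move=> cF; elim: r => [|i r IHr].
  by under eq_fun do rewrite big_nil; exact: ccont_cst.
under eq_fun do rewrite big_cons.
by case: (P i) => //; apply: ccontD.
Qed.

Lemma ccont_prod (I : Type) (r : seq I) (P : pred I) (F : I -> T -> R[i]) :
  (forall i, ccont (F i)) -> ccont (fun t => \prod_(i <- r | P i) F i t).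
Proof.
move=> cF; elim: r => [|i r IHr].
  by under eq_fun do rewrite big_nil; exact: ccont_cst.
under eq_fun do rewrite big_cons.
by case: (P i) => //; apply: ccontM.
Qed.

Lemma ccont_det n (M : T -> 'M[R[i]]_n) :
  (forall i j, ccont (fun t => M t i j)) -> ccont (fun t => \det (M t)).
Proof.
by move=> cM; apply: ccont_sum => s; apply: ccontM;
  [exact: ccont_cst | apply: ccont_prod].
Qed.

Lemma continuous_nsq f : ccont f -> continuous (fun t => nsq (f t)).
Proof.
by move=> [f1 f2] t; apply: cvgD; apply: cvgM; [exact: f1..|exact: f2|exact: f2].
Qed.

End ComplexContinuity.

Section MaximumModulus.
Variables (R : realType) (n : nat) (B : 'M[R[i]]_n).
Implicit Types (d e : 'rV[R[i]]_n) (l m x : R[i]).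

(** Its determinant vanishes exactly when l is an eigenvalue of Delta B, where Delta = diag d. *)
Definition pencil d l : 'M[R[i]]_n := l%:M - diag_mx d *m B.

Lemma pencilE d l i j : pencil d l i j = l *+ (i == j) - d ord0 i * B i j.
Proof. by rewrite /pencil mul_diag_mx !mxE. Qed.

Definition in_polydisc d := forall k, nsq (d ord0 k) <= 1.

(** A diagonal matrix with entries in the unit disc does not increase norms, so a bound for B bounds
    every root. This makes the set of roots compact. *)
Lemma pencil_root_bound : exists2 F : R, 0 <= F &
  forall d l, in_polydisc d -> \det (pencil d l) = 0 -> nsq l <= F.
Proof.
have [F leF] := vnsq_mulmx_bound B.
exists `|F| => // d l d1 /eqP/det0_colP[u u0].
rewrite mulmxBl mul_scalar_mx => /eqP; rewrite subr_eq0 => /eqP lu.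
rewrite -(ler_pM2r (_ : 0 < vnsq u)) ?vnsq_gt0 // -vnsqZ lu.
apply: le_trans (_ : F * vnsq u <= _); last first.
  by rewrite ler_wpM2r ?vnsq_ge0 ?ler_norm.
apply: le_trans (leF u); rewrite -mulmxA; apply: ler_sum => i _.
by rewrite mul_diag_mx !mxE nsqM ler_piMl ?nsq_ge0.
Qed.

(** The pairs (d, l) with d in the polydisc and l a root form a compact set in real coordinates, on
    which |l|^2 is continuous. *)
Lemma polydisc_max_root : (0 < n)%N -> exists d l, [/\ in_polydisc d,
  \det (pencil d l) = 0 &
  forall e m, in_polydisc e -> \det (pencil e m) = 0 -> nsq m <= nsq l].
Proof.
move=> n0; have [F F0 leF] := pencil_root_bound.
pose T := (('rV[R]_n * 'rV[R]_n) * (R * R))%type.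
pose dt (t : T) : 'rV[R[i]]_n := \row_k (t.1.1 ord0 k +i* t.1.2 ord0 k).
pose lt (t : T) : R[i] := t.2.1 +i* t.2.2.
have c11 k : continuous (fun t : T => t.1.1 ord0 k).
  move=> t; apply: (@continuous_comp _ _ _ (fun t : T => t.1.1) (fun v : 'rV[R]_n => v ord0 k)).
    by apply: (@continuous_comp _ _ _ (fun t : T => t.1) fst); exact: cvg_fst.
  exact: coord_continuous.
have c12 k : continuous (fun t : T => t.1.2 ord0 k).
  move=> t; apply: (@continuous_comp _ _ _ (fun t : T => t.1.2) (fun v : 'rV[R]_n => v ord0 k)).
    by apply: (@continuous_comp _ _ _ (fun t : T => t.1) snd); [exact: cvg_fst|exact: cvg_snd].
  exact: coord_continuous.
have c21 : continuous (fun t : T => t.2.1).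
  by move=> t; apply: (@continuous_comp _ _ _ (fun t : T => t.2) fst);
    [exact: cvg_snd|exact: cvg_fst].
have c22 : continuous (fun t : T => t.2.2).
  by move=> t; apply: (@continuous_comp _ _ _ (fun t : T => t.2) snd); exact: cvg_snd.
have cl : ccont lt by exact: ccont_pair.
have cd k : ccont (fun t => dt t ord0 k).
  by under eq_fun do rewrite mxE; exact: ccont_pair.
have cdet : ccont (fun t => \det (pencil (dt t) (lt t))).
  apply: ccont_det => i j; under eq_fun do rewrite pencilE.
  apply: ccontD.
    by case: eqP => _; rewrite ?mulr1n //; under eq_fun do rewrite mulr0n; exact: ccont_cst.
  by apply: ccontN; apply: ccontM => //; exact: ccont_cst.
pose box : set 'rV[R]_n := [set v | forall k, `[-1, 1]%classic (v ord0 k)].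
have cbox : compact box.
  by apply: (@rV_compact R n (fun=> `[-1, 1]%classic)) => k; exact: segment_compact.
(* A root has |l|^2 <= F <= (1 + F)^2, so its two coordinates lie within 1 + F. *)
pose seg : set R := `[- (1 + F), 1 + F]%classic.
have cseg : compact seg by exact: segment_compact.
pose K : set T := ((box `*` box) `*` (seg `*` seg)) `&`
  ([set t | nsq (\det (pencil (dt t) (lt t))) = 0] `&`
   \bigcap_k [set t | nsq (dt t ord0 k) <= 1]).
have cK : compact K.
  apply: compact_closedI; first by do 2!apply: compact_setX => //; apply: compact_setX.
  apply: closedI.
    apply: (@preimage_closed _ _ (fun t => nsq (\det (pencil (dt t) (lt t)))) [set 0]).
      by move=> t _; apply: (continuous_nsq cdet).
    exact: closed_eq.
  apply: closed_bigI => k _.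
  apply: (@preimage_closed _ _ (fun t => nsq (dt t ord0 k)) [set x | x <= 1]).
    by move=> t _; apply: (continuous_nsq (cd k)).
  exact: closed_le.
have sq1 (a b c : R) : 0 <= c -> a ^+ 2 + b ^+ 2 <= c ^+ 2 -> -c <= a <= c.
  move=> c0 abc; rewrite -ler_norml -[c]ger0_norm // -ler_sqr ?nnegrE //.
  by rewrite !real_normK ?num_real // (le_trans _ abc) // lerDl sqr_ge0.
have KP e m : in_polydisc e -> \det (pencil e m) = 0 ->
    exists2 t, K t & dt t = e /\ lt t = m.
  move=> e1 em.
  pose t : T := ((\row_k complex.Re (e ord0 k), \row_k complex.Im (e ord0 k)),
                 (complex.Re m, complex.Im m)).
  have dte : dt t = e by apply/rowP => k; rewrite !mxE /=; case: (e ord0 k).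
  have lte : lt t = m by rewrite /lt /=; case: (m).
  exists t => //.
    split; last by split; [rewrite /= dte lte em nsq0|move=> k _; rewrite /= dte].
    have mF : nsq m <= (1 + F) ^+ 2.
      apply: le_trans (leF _ _ e1 em) _.
      by have := sqr_ge0 F; lra.
    have c0 : 0 <= 1 + F by rewrite addr_ge0.
    split; split => /=.
    - move=> k; rewrite mxE /= in_itv /=; apply: (sq1 _ (complex.Im (e ord0 k))) => //.
      by rewrite expr1n; exact: e1.
    - move=> k; rewrite mxE /= in_itv /=; apply: (sq1 _ (complex.Re (e ord0 k))) => //.
      by rewrite expr1n addrC; exact: e1.
    - by rewrite /seg /= in_itv /=; apply: (sq1 _ (complex.Im m)).
    - by rewrite /seg /= in_itv /=; apply: (sq1 _ (complex.Re m)); rewrite // addrC.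
(* The compact set is nonempty: at d = (1, ..., 1) the roots are the eigenvalues of B. *)
have [a Ba] := eigenvalue_closed B n0.
have p1 : in_polydisc (const_mx 1) by move=> k; rewrite mxE nsqR expr1n.
have det1 : \det (pencil (const_mx 1) a) = 0.
  by apply/eqP; rewrite /pencil diag_const_mx mul1mx -eigenvalue_det.
have K0 : K !=set0 by have [t Kt _] := KP _ _ p1 det1; exists t.
have [t] := compact_EVT_max K0 cK (continuous_subspaceT (continuous_nsq cl)).
rewrite inE => -[_ [/eqP + t1]] tmax; rewrite nsq_eq0 => /eqP t0.
exists (dt t), (lt t); split=> // [k|e m e1 em]; first exact: t1.
by have [s Ks [_ <-]] := KP _ _ e1 em; apply: tmax; rewrite inE.
Qed.

Definition update d k x : 'rV[R[i]]_n := \row_j if j == k then x else d ord0 j.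

(** Row k is the derivative in d_k of row k of the pencil, so the determinant is the coefficient of
    d_k in the affine function. *)
Definition pencil_slope d k l : 'M[R[i]]_n :=
  \matrix_(i, j) if i == k then - B k j else pencil d l i j.

(** Only row k involves x, and affinely; the determinant is linear in that row. *)
Lemma det_pencil_update d k l x : \det (pencil (update d k x) l) =
  \det (pencil (update d k 0) l) + x * \det (pencil_slope d k l).
Proof.
rewrite /pencil_slope -[\det (pencil (update d k 0) l)]mul1r.
move: (pencilE (update d k x) l) (pencilE (update d k 0) l) (pencilE d l).
move: (pencil _ _) (pencil _ _) (pencil _ _) => P Q S PE QE SE.
apply: (@determinant_multilinear _ _ _ _ _ k).
- by apply/rowP => j; rewrite !(mxE, PE, QE, eqxx) mul0r subr0 mul1r mulrN.
- by apply/matrixP => i j; rewrite !(mxE, PE, QE) !(eq_sym (lift _ _) k) (negPf (neq_lift _ _)).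
- apply/matrixP => i j; rewrite !(mxE, PE, SE).
  by rewrite !(eq_sym (lift _ _) k) (negPf (neq_lift _ _)).
Qed.

Lemma update_id d k : update d k (d ord0 k) = d.
Proof. by apply/rowP => j; rewrite mxE; case: eqP => [->|]. Qed.

(* The determinant is affine in the k-th variable. If the slope does not vanish
   and |d_k| < 1, then a slightly larger l still has a root d_k in the disc. *)
Lemma max_root_slope d l k : in_polydisc d -> \det (pencil d l) = 0 ->
  (forall e m, in_polydisc e -> \det (pencil e m) = 0 -> nsq m <= nsq l) ->
  nsq (d ord0 k) < 1 -> \det (pencil_slope d k l) = 0.
Proof.
move=> d1 dl maxl dk; apply/eqP; apply/negPn/negP => slope.
(* l is pushed outwards along its own ray, or along 1 when l = 0, so that |l + t u| > |l| for t >
   0. *)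
pose u : R[i] := if l == 0 then 1 else l.
pose lt (t : R) := l + t%:C * u.
have cl : ccont lt.
  apply: ccontD (ccont_cst _ _) (ccontM _ (ccont_cst _ _)).
  by apply: (ccont_pair (b := fun=> 0)) => t; [exact: cvg_id|exact: cvg_cst].
have cpencil e i j : ccont (fun t => pencil e (lt t) i j).
  under eq_fun do rewrite pencilE.
  apply: ccontD (ccont_cst _ _).
  by case: eqP => _; rewrite ?mulr1n //; under eq_fun do rewrite mulr0n; exact: ccont_cst.
pose a t := \det (pencil (update d k 0) (lt t)).
pose b t := \det (pencil_slope d k (lt t)).
have ca : ccont a by apply: ccont_det => i j.
have cb : ccont b.
  apply: ccont_det => i j; under eq_fun do rewrite mxE.
  by case: eqP => // _; exact: ccont_cst.
have lt0 : lt 0 = l by rewrite /lt mul0r addr0.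
(* At t = 0 the root d_k = - a / b lies in the open disc. Written without division, this is an open
   condition that persists for small t. *)
have h0 : 0 < nsq (b 0) - nsq (a 0).
  have : a 0 = - (d ord0 k * b 0).
    by apply/eqP; rewrite -addr_eq0 /a /b lt0 -det_pencil_update update_id dl.
  move=> ->; rewrite -[nsq (- _)]mul1r -{1}(expr1n _ 2) -sqrrN -nsqR -nsqM.
  by rewrite rmorphN mulrNN mul1r nsqM subr_gt0 gtr_pMl // nsq_gt0 /b lt0.
have ch : (nsq (b t) - nsq (a t)) @[t --> (0 : R)^'+] --> nsq (b 0) - nsq (a 0).
  apply: cvg_at_right_filter; apply: cvgB.
    exact: (continuous_nsq cb).
  exact: (continuous_nsq ca).
have [t [t0 ht]] : exists t : R, 0 < t /\ 0 < nsq (b t) - nsq (a t).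
  apply: (@filter_ex _ (0 : R)^'+).
  apply: filterS2 (nbhs_right_gt 0) (cvgr_gt _ ch _ h0) => t; exact: conj.
have bt : b t != 0.
  by rewrite -nsq_gt0; apply: le_lt_trans (nsq_ge0 (a t)) _; rewrite -subr_gt0.
(* - a / b is the zero in the k-th variable of the affine function a + x b at [lt t]. *)
have := maxl (update d k (- (a t / b t))) (lt t).
rewrite det_pencil_update -/(a t) -/(b t) mulNr divfK // subrr.
move=> /(_ _ erefl); have -> : nsq (lt t) <= nsq l = false.
  apply/negbTE; rewrite -ltNge /lt /u; have [->|l0] := eqVneq l 0.
    by rewrite add0r mulr1 nsq0 nsqR exprn_gt0.
  rewrite -{2}[l]mul1r -mulrDl -(rmorph1 (real_complex R)) -rmorphD nsqM nsqR.
  rewrite ltr_pMl ?nsq_gt0 // exprn_egt1 //.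
  by rewrite ltrDl.
move=> E; suff /E : in_polydisc (update d k (- (a t / b t))) by [].
move=> j; rewrite mxE; case: eqP => // _.
rewrite -mulNr nsqM nsqV ler_pdivrMr ?nsq_gt0 // mul1r.
by have := ltW ht; rewrite subr_ge0 /nsq !raddfN /= !sqrrN.
Qed.

(** Coordinates are moved to the unit circle one at a time. If |d_k| < 1, the slope vanishes, so the
    determinant does not depend on d_k, which may be replaced by 1 with the same l. *)
Lemma torus_max_root : (0 < n)%N -> exists d l,
  [/\ forall k, nsq (d ord0 k) = 1, \det (pencil d l) = 0 &
  forall e m, in_polydisc e -> \det (pencil e m) = 0 -> nsq m <= nsq l].
Proof.
move=> n0; suff /(_ n) [d [l [d1 du dl maxl]]] : forall p, exists d l,
    [/\ in_polydisc d, forall k : 'I_n, (k < p)%N -> nsq (d ord0 k) = 1,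
      \det (pencil d l) = 0 &
      forall e m, in_polydisc e -> \det (pencil e m) = 0 -> nsq m <= nsq l].
  by exists d, l; split=> // k; apply: du.
elim=> [|p [d [l [d1 du dl maxl]]]].
  by have [d [l [d1 dl maxl]]] := polydisc_max_root n0; exists d, l; split.
have [np|pn] := leqP n p.
  by exists d, l; split=> // k _; apply: du; apply: leq_trans np.
pose k := Ordinal pn.
have [dk|] := eqVneq (nsq (d ord0 k)) 1.
  exists d, l; split=> // j; rewrite ltnS leq_eqVlt => /predU1P[jp|]; last exact: du.
  by rewrite (_ : j = k) //; exact: val_inj.
move=> dk; have {}dk : nsq (d ord0 k) < 1 by rewrite lt_neqAle dk d1.
have slope := max_root_slope d1 dl maxl dk.
exists (update d k 1), l; split; [| | |exact: maxl].
- by move=> j; rewrite mxE; case: eqP => // _; rewrite nsqR expr1n.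
- move=> j; rewrite ltnS mxE; case: eqP => [_ _|jk]; first by rewrite nsqR expr1n.
  rewrite leq_eqVlt => /predU1P[jp|]; last exact: du.
  by case: jk; exact: val_inj.
- have := det_pencil_update d k l (d ord0 k).
  rewrite update_id dl slope mulr0 addr0 => d0.
  by rewrite det_pencil_update slope mulr0 addr0 -d0.
Qed.

End MaximumModulus.

(** * The gap as a difference *)

Section Gap.
Variables (R : realType) (n : nat).
Implicit Types (B S U : 'M[R[i]]_n) (v : 'cV[R[i]]_n).

Lemma normc_le_nsq (z w : R[i]) : (normc z <= normc w) = (nsq z <= nsq w).
Proof. by rewrite -!normc_sqr ler_pXn2r ?nnegrE ?normc_ge0. Qed.

Lemma unimod_diagP U : unimod_diag U ->
  exists2 d : 'rV[R[i]]_n, U = diag_mx d & forall k, nsq (d ord0 k) = 1.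
Proof.
case=> /diag_mxP[d ->] U1; exists d => // k.
by have := U1 k; rewrite mxE eqxx mulr1n -normc_sqr => ->; rewrite expr1n.
Qed.

Lemma unimod_diag_mx (d : 'rV[R[i]]_n) : (forall k, nsq (d ord0 k) = 1) ->
  unimod_diag (diag_mx d).
Proof.
move=> d1; split=> [|k]; first by apply/diag_mxP; exists d.
by rewrite mxE eqxx mulr1n normcE d1 sqrtr1.
Qed.

(** m is the modulus of the largest root over the polydisc, which the torus attains. For the second
    clause, e_k = b v_k / (B v)_k lies in the disc and v is in the kernel of b - diag(e) B, so b is
    a root. *)
Lemma rotated_radii_max B : (0 < n)%N -> exists2 m : R,
  is_max (rotated_radii B) m &
  forall (b : R) v, 0 <= b -> v != 0 ->
    (forall k, b ^+ 2 * nsq (v k ord0) <= nsq ((B *m v) k ord0)) -> b <= m.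
Proof.
move=> n0; have [d [l [d1 dl maxl]]] := torus_max_root B n0.
have maxU U a : unimod_diag U -> eigenvalue (U *m B) a -> normc a <= normc l.
  move=> /unimod_diagP[e -> e1]; rewrite eigenvalue_det => /eqP ea.
  by rewrite normc_le_nsq (maxl e) // => k; rewrite e1.
exists (normc l); first split.
- exists (diag_mx d); first exact: unimod_diag_mx.
  apply/eqP; rewrite eq_le spectral_radius_ub ?andbT; last first.
    by rewrite eigenvalue_det; apply/eqP.
  have [a da <-] := spectral_radius_attained (diag_mx d *m B) n0.
  exact: maxU (unimod_diag_mx d1) da.
- move=> _ [U Uu <-].
  by have [a da <-] := spectral_radius_attained (U *m B) n0; apply: maxU da.
move=> b v b0 v0 leb; have [->|bN0] := eqVneq b 0; first exact: normc_ge0.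
have b_gt0 : 0 < b by rewrite lt_def bN0.
have -> : b = normc b%:C by rewrite normcE nsqR sqrtr_sqr ger0_norm.
(* Where (B v)_k = 0 the quotient is 0 by convention; this is harmless, as v_k = 0 there by
   hypothesis. *)
pose e := \row_k (b%:C * v k ord0 / (B *m v) k ord0).
rewrite normc_le_nsq; apply: (maxl e).
  move=> k; rewrite mxE !nsqM nsqV nsqR.
  have [->|Bv0] := eqVneq ((B *m v) k ord0) 0; first by rewrite nsq0 invr0 mulr0.
  by rewrite ler_pdivrMr ?nsq_gt0 // mul1r.
apply/eqP/det0_colP; exists v => //.
rewrite mulmxBl mul_scalar_mx -mulmxA; apply/eqP; rewrite subr_eq0; apply/eqP/colP => k.
rewrite mul_diag_mx [RHS]mxE [X in _ = X * _]mxE [LHS]mxE.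
have [Bv0|Bv0] := eqVneq ((B *m v) k ord0) 0; last by rewrite divfK.
suff -> : v k ord0 = 0 by rewrite Bv0 !mulr0.
apply/eqP; rewrite -nsq_eq0 eq_le nsq_ge0 andbT.
by have := leb k; rewrite Bv0 nsq0 pmulr_rle0 // exprn_gt0.
Qed.

Lemma pos_diag1 : pos_diag (1%:M : 'M[R[i]]_n).
Proof. by split=> [|k]; [exact: scalar_mx_is_diag | rewrite mxE eqxx ltr01]. Qed.

Lemma inf_scaled_norm_le B S : pos_diag S -> inf_scaled_norm B <= opnorm (S *m B *m invmx S).
Proof.
move=> Sp; apply: ge_inf; last by exists S.
by exists 0 => _ [T _ <-]; apply: opnorm_ge0.
Qed.

Lemma inf_scaled_norm_ge B (c : R) :
  (forall S, pos_diag S -> c <= opnorm (S *m B *m invmx S)) -> c <= inf_scaled_norm B.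
Proof.
move=> cB; apply: lb_le_inf; last by move=> _ [S Sp <-]; apply: cB.
by exists (opnorm (1%:M *m B *m invmx 1%:M)), 1%:M => //; exact: pos_diag1.
Qed.

Lemma spectral_radius_scaled B S U : pos_diag S ->
  spectral_radius (S *m U *m B *m invmx S) = spectral_radius (U *m B).
Proof. by move=> Sp; rewrite -(mulmxA S U) spectral_radius_conj ?pos_diag_unit. Qed.

(** The norm depends on S alone and the spectral radius on U alone, so the infimum splits. *)
Lemma inf_gapE B m : (0 < n)%N -> is_max (rotated_radii B) m ->
  inf_gap B = inf_scaled_norm B - m.
Proof.
move=> n0 [[U0 Uu0 mE] maxm]; apply/eqP; rewrite eq_le; apply/andP; split.
  rewrite lerBrDr; apply: inf_scaled_norm_ge => S Sp; rewrite -lerBrDr.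
  apply: ge_inf.
    exists 0 => _ [T _ [V _ <-]]; rewrite subr_ge0.
    exact: spectral_radius_le_opnorm.
  by exists S => //; exists U0 => //; rewrite opnorm_unimod // spectral_radius_scaled // mE.
apply: lb_le_inf.
  exists (opnorm (1%:M *m U0 *m B *m invmx 1%:M) - spectral_radius (1%:M *m U0 *m B *m invmx 1%:M)).
  by exists 1%:M; [exact: pos_diag1|exists U0].
move=> _ [S Sp [U Uu <-]]; rewrite opnorm_unimod // spectral_radius_scaled //.
apply: lerB; first exact: inf_scaled_norm_le.
by apply: maxm; exists U.
Qed.

Lemma inf_scaled_norm_ge_max B m : (0 < n)%N -> is_max (rotated_radii B) m ->
  m <= inf_scaled_norm B.
Proof.
move=> n0 [[U Uu <-] _]; apply: inf_scaled_norm_ge => S Sp.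
rewrite -(spectral_radius_scaled B U Sp) -(opnorm_unimod B Sp Uu).
exact: spectral_radius_le_opnorm.
Qed.

(** With S = diag(sqrt d_k), the hypothesis reads |S B w|^2 <= b^2 |S w|^2 - c |w|^2. Since |S w|^2
    <= D |w|^2 for D the sum of the d_k, the scaled norm is at most sqrt(b^2 - c / D) < b. *)
Lemma inf_scaled_norm_lt B (d : 'I_n -> R) (b c : R) : (0 < n)%N -> 0 <= b -> 0 < c ->
  (forall k, 0 < d k) ->
  (forall w : 'cV[R[i]]_n, \sum_k d k * nsq ((B *m w) k ord0)
     <= b ^+ 2 * (\sum_k d k * nsq (w k ord0)) - c * vnsq w) ->
  inf_scaled_norm B < b.
Proof.
move=> n0 b0 c0 d0 dB; pose s k := Num.sqrt (d k).
pose S : 'M[R[i]]_n := diag_mx (\row_k (s k)%:C).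
have Sp : pos_diag S.
  split=> [|k]; first by apply/diag_mxP; exists (\row_k (s k)%:C).
  by rewrite !mxE eqxx mulr1n ltcR sqrtr_gt0.
have SE (w : 'cV[R[i]]_n) : vnsq (S *m w) = \sum_k d k * nsq (w k ord0).
  apply: eq_bigr => k _; rewrite is_diag_mulmxE ?Sp.1 // !mxE eqxx mulr1n.
  by rewrite nsqM nsqR sqr_sqrtr // ltW.
pose D := \sum_k d k.
have D0 : 0 < D.
  rewrite /D (bigD1 (Ordinal n0)) //= ltr_pwDl //.
  by apply: sumr_ge0 => k _; exact: ltW.
have leD (w : 'cV[R[i]]_n) : vnsq (S *m w) <= D * vnsq w.
  rewrite SE /D mulr_suml; apply: ler_sum => k _.
  by rewrite ler_wpM2l ?nsq_le_vnsq // ltW.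
(* Testing on a vector e with |S e| = 1 shows that the radicand is nonnegative, which also excludes
   b = 0. *)
have /andP[b_gt0 bcD] : (0 < b) && (0 <= b ^+ 2 - c / D).
  pose e : 'cV[R[i]]_n := invmx S *m delta_mx (Ordinal n0) ord0.
  have e1 : vnsq (S *m e) = 1.
    rewrite mulKVmx ?pos_diag_unit // /vnsq (bigD1 (Ordinal n0)) //= big1 => [|k k0].
      by rewrite mxE !eqxx /= addr0 nsqR expr1n.
    by rewrite mxE (negPf k0) nsq0.
  have le_e : vnsq (S *m (B *m e)) <= b ^+ 2 - c * vnsq e.
    by rewrite (SE (B *m e)); apply: le_trans (dB e) _; rewrite -(SE e) e1 mulr1.
  have cDe : c / D <= c * vnsq e.
    by rewrite ler_pM2l // -(ler_pM2l D0) divff ?gt_eqF // -e1.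
  have cD : 0 < c / D by rewrite divr_gt0.
  have SBe := vnsq_ge0 (S *m (B *m e)).
  have bcD : 0 <= b ^+ 2 - c / D.
    by apply: le_trans SBe (le_trans le_e _); rewrite lerB.
  rewrite bcD andbT lt_def b0 andbT; apply: contraTneq bcD => ->.
  by rewrite expr0n /= sub0r oppr_ge0 -ltNge.
apply: le_lt_trans (inf_scaled_norm_le B Sp) _.
apply: le_lt_trans (_ : Num.sqrt (b ^+ 2 - c / D) < b); last first.
  rewrite -[ltRHS]ger0_norm // -[ltRHS]sqrtr_sqr ltr_sqrt ?exprn_gt0 //.
  by rewrite gtrBl divr_gt0.
apply: opnorm_le; rewrite ?sqrtr_ge0 // => u u1; rewrite sqr_sqrtr //.
pose w := invmx S *m u; have wE : S *m w = u by rewrite mulKVmx ?pos_diag_unit.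
have -> : S *m B *m invmx S *m u = S *m (B *m w) by rewrite !mulmxA.
rewrite SE; apply: le_trans (dB w) _; rewrite -SE wE u1 mulr1 lerB //.
rewrite ler_pM2l // -(ler_pM2l D0) divff ?gt_eqF // -u1 -wE.
exact: leD.
Qed.

End Gap.

(** * Cholesky factorization *)

Section Cholesky.
Variable C : numClosedFieldType.

Definition psd N (M : 'M[C]_N) := M^t* = M /\
  forall w : 'cV[C]_N, 0 <= (w^t* *m M *m w) ord0 ord0.

(* [c = true] stands for the complex field and [c = false] for the real one. *)
Definition entries_over (c : bool) m n (M : 'M[C]_(m, n)) : bool := c || (map_mx conjC M == M).

Lemma adjmxM m n p (A : 'M[C]_(m, n)) (B : 'M[C]_(n, p)) : (A *m B)^t* = B^t* *m A^t*.
Proof. by rewrite trmx_mul map_mxM. Qed.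

Lemma adjmxD m n (A B : 'M[C]_(m, n)) : (A + B)^t* = A^t* + B^t*.
Proof. by rewrite linearD map_mxD. Qed.

Lemma adjmxB m n (A B : 'M[C]_(m, n)) : (A - B)^t* = A^t* - B^t*.
Proof. by rewrite linearB map_mxB. Qed.

Lemma adjmxZ m n a (A : 'M[C]_(m, n)) : (a *: A)^t* = conjC a *: A^t*.
Proof. by rewrite linearZ map_mxZ. Qed.

Lemma adj_scalar_mx n a : (a%:M : 'M[C]_n)^t* = (conjC a)%:M.
Proof. by rewrite tr_scalar_mx map_scalar_mx. Qed.

Lemma adj_col_mx m1 m2 n (A : 'M[C]_(m1, n)) (B : 'M[C]_(m2, n)) :
  (col_mx A B)^t* = row_mx (A^t*) (B^t*).
Proof. by rewrite tr_col_mx map_row_mx. Qed.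

Lemma adj_block_mx m1 m2 n1 n2 (A : 'M[C]_(m1, n1)) (B : 'M[C]_(m1, n2))
    (D : 'M[C]_(m2, n1)) (E : 'M[C]_(m2, n2)) :
  (block_mx A B D E)^t* = block_mx (A^t*) (D^t*) (B^t*) (E^t*).
Proof. by rewrite tr_block_mx map_block_mx. Qed.

Lemma adjmx_mul_ge0 N (y : 'cV[C]_N) : 0 <= (y^t* *m y) ord0 ord0.
Proof.
rewrite mxE; apply: sumr_ge0 => i _.
by rewrite !mxE mulrC -normCK exprn_ge0.
Qed.

Lemma adjmx_mul_eq0 N (y : 'cV[C]_N) : (y^t* *m y) ord0 ord0 = 0 -> y = 0.
Proof.
rewrite mxE => /eqP; rewrite psumr_eq0 => [/allP y0|i _].
  apply/colP => i; have := y0 i (mem_index_enum i).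
  by rewrite !mxE mulrC -normCK expf_eq0 normr_eq0 => /eqP.
by rewrite !mxE mulrC -normCK exprn_ge0.
Qed.

Lemma psd_mul_adj m n (L : 'M[C]_(m, n)) : psd (L *m L^t*).
Proof.
split=> [|w]; first by rewrite adjmxM trmxCK.
rewrite mulmxA -mulmxA -[w^t* *m L]trmxCK adjmxM trmxCK.
exact: adjmx_mul_ge0.
Qed.

Lemma psdD N (M P : 'M[C]_N) : psd M -> psd P -> psd (M + P).
Proof.
move=> [hM pM] [hP pP]; split=> [|w]; first by rewrite adjmxD hM hP.
by rewrite mulmxDr mulmxDl mxE addr_ge0.
Qed.

Lemma psdZ N a (M : 'M[C]_N) : 0 <= a -> psd M -> psd (a *: M).
Proof.
move=> a0 [hM pM]; split=> [|w]; first by rewrite adjmxZ hM geC0_conj.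
by rewrite -scalemxAr -scalemxAl mxE mulr_ge0.
Qed.

Section Block.
Variables (N : nat) (a : C) (B : 'cV[C]_N) (D : 'M[C]_N).
Hypothesis psdM : psd (block_mx (a%:M : 'M_1) (B^t*) B D).

Lemma psd_block_form (x : C) (y : 'cV[C]_N) :
  0 <= (((conjC x)%:M *m (a%:M *m x%:M + B^t* *m y)
         + y^t* *m (B *m x%:M + D *m y)) : 'M_1) ord0 ord0.
Proof.
have := psdM.2 (col_mx x%:M y).
by rewrite -mulmxA mul_block_col adj_col_mx mul_row_col adj_scalar_mx.
Qed.

Lemma psd_block_ge0 : 0 <= a.
Proof.
have := psd_block_form 1 0.
by rewrite !mulmx0 addr0 trmx0 map_mx0 mul0mx addr0 conjC1 !mulmx1 mul1mx mxE.
Qed.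

Lemma psd_block_dr : psd D.
Proof.
split=> [|y]; last first.
  have := psd_block_form 0 y; rewrite conjC0 !raddf0 mul0mx !add0r mulmxA; exact.
have := psdM.1; rewrite adj_block_mx => /(congr1 (@drsubmx _ 1 N 1 N)).
by rewrite !block_mxKdr.
Qed.

(** At the vector (x, B) with x real, the form is 2 x q + r where q = |B|^2. If q were positive, the
    chosen x would give the value -1. *)
Lemma psd_block_a0 : a = 0 -> B = 0.
Proof.
move=> a0; apply: adjmx_mul_eq0.
set q := (_ *m _) _ _; have q0 : 0 <= q by apply: adjmx_mul_ge0.
apply/eqP; apply/negPn/negP => qN0.
pose r := (B^t* *m D *m B) ord0 ord0.
have r0 : 0 <= r by exact: psd_block_dr.2.
pose x := - ((r + 1) / (2 * q)).
have xr : conjC x = x.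
  by rewrite /x rmorphN /= geC0_conj // divr_ge0 ?addr_ge0 ?mulr_ge0 ?ler01 ?ler0n.
have xE (P : 'M[C]_1) : (x *: P) ord0 ord0 = x * P ord0 ord0 by rewrite mxE.
have := psd_block_form x B; rewrite a0 raddf0 mul0mx add0r xr.
rewrite mul_scalar_mx mul_mx_scalar mulmxDr -scalemxAr mulmxA mxE [X in _ + X]mxE !xE -/q -/r.
have -> : x * q + (x * q + r) = - 1.
  by rewrite addrA -mulrDl -mulr2n -mulr_natl /x mulrN mulNr -mulrA; field.
by rewrite ler0N1.
Qed.

(** Completing the square: x = - a^-1 B^* y minimizes the form for fixed y, and the minimum is the
    form of the Schur complement. *)
Lemma psd_schur : 0 < a -> psd (D - a^-1 *: (B *m B^t*)).
Proof.
move=> a0; split=> [|y].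
  by rewrite adjmxB adjmxZ adjmxM trmxCK psd_block_dr.1 geC0_conj // invr_ge0 ltW.
pose z := (B^t* *m y) ord0 ord0.
have zE : B^t* *m y = z%:M by exact: mx11_scalar.
have := psd_block_form (- (a^-1 * z)) y.
rewrite zE -scalar_mxM -raddfD /= mulrN mulVKf ?gt_eqF // addNr raddf0 mulmx0 add0r.
have -> : B *m (- (a^-1 * z))%:M = - (a^-1 *: (B *m B^t* *m y)).
  by rewrite -mulmxA zE !mul_mx_scalar scalerA scaleNr.
by rewrite -(mulmxA (y^t* )) mulmxBl -scalemxAl [_ + D *m y]addrC.
Qed.

End Block.

Lemma over_conj c m n (M : 'M[C]_(m, n)) : entries_over c M -> ~~ c -> map_mx conjC M = M.
Proof. by case/orP=> [->|/eqP]. Qed.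

Lemma overP c m n (M : 'M[C]_(m, n)) : (~~ c -> map_mx conjC M = M) -> entries_over c M.
Proof. by rewrite /entries_over; case: c => //= ->. Qed.

Lemma over_mulmx c m n p (A : 'M[C]_(m, n)) (B : 'M[C]_(n, p)) :
  entries_over c A -> entries_over c B -> entries_over c (A *m B).
Proof.
by move=> cA cB; apply: overP => c0; rewrite map_mxM (over_conj cA) ?(over_conj cB).
Qed.

(** Induction on the Schur complement. Only square roots of nonnegative pivots occur, so real
    entries stay real. The last clause turns singularity into a column that can be discarded. *)
Lemma cholesky c N (M : 'M[C]_N) : psd M -> entries_over c M ->
  exists L : 'M[C]_N, [/\ entries_over c L, M = L *m L^t* & \det L = 0 -> exists j, col j L = 0].
Proof.
elim: N M => [|N IHN] M.
  move=> _ _; exists 0; split; last by rewrite det_mx00 => /eqP; rewrite oner_eq0.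
    by apply: overP => _; apply/matrixP => -[].
  by apply/matrixP => -[].
move: M; rewrite -[N.+1]/(1 + N)%N => M; rewrite -[M]submxK.
set a := ulsubmx M; set B' := ursubmx M; set B := dlsubmx M; set D := drsubmx M.
rewrite (mx11_scalar a); move: (a ord0 ord0) => {}a psdM cM.
have B'E : B' = B^t*.
  have := psdM.1; rewrite adj_block_mx => /(congr1 (@ursubmx _ 1 N 1 N)).
  by rewrite !block_mxKur.
rewrite B'E in psdM cM *; move: B D {B' B'E} psdM cM => B D {M} psdM cM.
have cB : entries_over c B.
  apply: overP => /(over_conj cM); rewrite map_block_mx => /(congr1 (@dlsubmx _ 1 N 1 N)).
  by rewrite !block_mxKdl.
have cD : entries_over c D.
  apply: overP => /(over_conj cM); rewrite map_block_mx => /(congr1 (@drsubmx _ 1 N 1 N)).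
  by rewrite !block_mxKdr.
have a_ge0 := psd_block_ge0 psdM.
(* A zero pivot forces B = 0, and the first column of the factor is then zero. *)
have [a0|aN0] := eqVneq a 0.
  have B0 := psd_block_a0 psdM a0.
  have [L [cL LE _]] := IHN D (psd_block_dr psdM) cD.
  exists (block_mx (0 : 'M_1) 0 0 L); split.
  - by apply: overP => c0; rewrite map_block_mx !map_mx0 (over_conj cL).
  - rewrite adj_block_mx mulmx_block !trmx0 !map_mx0 !mul0mx !mulmx0 !addr0 add0r -LE.
    by rewrite a0 B0 raddf0 trmx0 map_mx0.
  - by exists (lshift N ord0); rewrite block_mxEh colKl col_mx0 col0.
have a_gt0 : 0 < a by rewrite lt_def aN0.
have [||L [cL LE colL]] := IHN (D - a^-1 *: (B *m B^t*)).
- exact: psd_schur.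
- apply: overP => c0; rewrite map_mxB map_mxZ map_mxM (over_conj cD) // (over_conj cB) //.
  by rewrite /= -!map_trmx !(over_conj cB) // geC0_conj ?invr_ge0.
pose s := sqrtC a.
have s2 : s * s = a by rewrite -expr2 sqrtCK.
have sr : conjC s = s by rewrite geC0_conj ?sqrtC_ge0.
have s0 : s != 0 by rewrite sqrtC_eq0.
exists (block_mx (s%:M : 'M_1) 0 (s^-1 *: B) L); split.
- apply: overP => c0; rewrite map_block_mx map_mx0 map_scalar_mx map_mxZ.
  by rewrite (over_conj cB) // (over_conj cL) // fmorphV /= sr.
- rewrite adj_block_mx mulmx_block trmx0 map_mx0 !mul0mx !mulmx0 !addr0.
  rewrite adj_scalar_mx adjmxZ fmorphV /= sr -LE -scalar_mxM s2.
  congr block_mx.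
  + by rewrite mul_scalar_mx scalerA divff // scale1r.
  + by rewrite mul_mx_scalar scalerA divff // scale1r.
  + by rewrite -scalemxAl -scalemxAr scalerA -invfM s2 addrC subrK.
- rewrite det_lblock det_scalar1 => /eqP; rewrite mulf_eq0 (negPf s0) => /eqP/colL[j L0].
  exists (rshift 1 j); rewrite block_mxEh colKr.
  by rewrite -!col_mx0; apply/eqP; rewrite col_col_mx L0 col0.
Qed.

End Cholesky.

(** * Lowering the number of columns *)

Section Reduction.
Variable R : realType.
Notation C := R[i].

Lemma conj_real (x : R) : conjC (x%:C : C) = x%:C.
Proof. exact: conjc_real. Qed.

Lemma nsq_mul_conj (z : C) : z * conjC z = (nsq z)%:C.
Proof. exact: mulC_conjc. Qed.

Lemma normr_normc (z : C) : `|z| = (normc z)%:C.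
Proof. by rewrite normc_def normcE. Qed.

(** In a unitary eigenbasis, let l be the inverse of the eigenvalue of D of largest modulus: every 1
    - l d_i is nonnegative and one of them is 0. This is where the line leaves the interior of the
    cone. *)
Lemma hermitian_singular_psd N (D : 'M[C]_N) : D^t* = D -> D != 0 ->
  exists2 l : C, conjC l = l & psd (1%:M - l *: D) /\ \det (1%:M - l *: D) = 0.
Proof.
move=> hD D0.
have hermD : D \is hermsymmx by apply/is_hermitianmxP; rewrite expr0 scale1r hD.
have [P [d [PU dR DE]]] : exists (P : 'M[C]_N) (d : 'rV[C]_N), [/\ P \is unitarymx,
    forall i, d ord0 i \is Num.real & D = P^t* *m diag_mx d *m P].
  exists (spectralmx D), (spectral_diag D); split; first exact: spectral_unitarymx.
    by move=> i; have /mxOverP := hermitian_spectral_diag_real hermD; apply.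
  rewrite -invmx_unitary ?spectral_unitarymx //.
  exact/orthomx_spectralP/hermitian_normalmx.
have PP : P^t* *m P = 1%:M by apply: mulmx1C; apply/unitarymxP.
case: N D D0 {hD hermD} P d PU dR DE PP => [D /eqP[]|N D D0 P d PU dR DE PP].
  by apply/matrixP => -[].
pose i0 := [arg max_(i > ord0) nsq (d ord0 i)]%O.
have maxd i : nsq (d ord0 i) <= nsq (d ord0 i0) by rewrite /i0; case: arg_maxP => // j _; apply.
have d0 : d ord0 i0 != 0.
  apply: contraNneq D0 => di0; have dz : d = 0.
    apply/rowP => i; rewrite mxE; apply/eqP; rewrite -nsq_eq0 eq_le nsq_ge0 andbT.
    by rewrite (le_trans (maxd i)) // di0 nsq0.
  by rewrite DE dz (raddf0 (@diag_mx C _)) mulmx0 mul0mx.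
pose l := (d ord0 i0)^-1.
have lR : l \is Num.real by rewrite realV.
pose e : 'rV[C]_N.+1 := \row_i (1 - l * d ord0 i).
have e0 i : 0 <= e ord0 i.
  rewrite mxE subr_ge0; apply: le_trans (real_ler_norm _) _; first by rewrite realM.
  rewrite normr_normc lecR normcE -[leRHS]sqrtr1 ler_wsqrtr // nsqM nsqV mulrC.
  by rewrite ler_pdivrMr ?nsq_gt0 // mul1r.
exists l; first exact: CrealP.
have -> : 1%:M - l *: D = P^t* *m diag_mx e *m P.
  have -> : diag_mx e = 1%:M - l *: diag_mx d.
    by apply/matrixP => i j; rewrite !mxE; case: eqP => _; rewrite ?mulr1n // !mulr0n mulr0 subr0.
  by rewrite mulmxBr mulmxBl mulmx1 PP -scalemxAr -scalemxAl -DE.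
split.
  pose s : 'rV[C]_N.+1 := \row_i sqrtC (e ord0 i).
  have -> : P^t* *m diag_mx e *m P = (P^t* *m diag_mx s) *m (P^t* *m diag_mx s)^t*.
    rewrite adjmxM trmxCK mulmxA; congr (_ *m _); rewrite -mulmxA; congr (_ *m _).
    apply/matrixP => i j; rewrite mul_diag_mx !mxE eq_sym.
    case: eqP => [->|_]; last by rewrite !mulr0n rmorph0 mulr0.
    have ej0 : 0 <= 1 - l * d ord0 i by have := e0 i; rewrite mxE.
    by rewrite !mulr1n geC0_conj ?sqrtC_ge0 // -expr2 sqrtCK.
  exact: psd_mul_adj.
rewrite !det_mulmx det_diag (bigD1 i0) //= mxE mulVf // subrr mul0r mulr0 mul0r //.
Qed.

Section Form.
Variables (n : nat) (B : 'M[C]_n) (b : R).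
Implicit Types (X : 'M[C]_n) (u v w : 'cV[C]_n).

(* The k-th constraint of the S-procedure, as a functional of X = v v^*. *)
Definition gain_form k X : C := (B *m X *m B^t*) k k - (b ^+ 2)%:C * X k k.

(** Nonnegativity for all k is the condition on v in [rotated_radii_max]. *)
Definition gain v k : R := nsq ((B *m v) k ord0) - b ^+ 2 * nsq (v k ord0).

Lemma gain_formD k X Y : gain_form k (X + Y) = gain_form k X + gain_form k Y.
Proof. by rewrite /gain_form mulmxDr mulmxDl !mxE mulrDr opprD addrACA. Qed.

Lemma gain_formZ k a X : gain_form k (a *: X) = a * gain_form k X.
Proof. by rewrite /gain_form -scalemxAr -scalemxAl !mxE mulrBr mulrCA. Qed.

Lemma gain_form_sum k (I : finType) (F : I -> 'M[C]_n) :
  gain_form k (\sum_i F i) = \sum_i gain_form k (F i).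
Proof.
apply: (big_morph _ (gain_formD k)).
by rewrite -(scale0r (0 : 'M[C]_n)) gain_formZ mul0r.
Qed.

Lemma mul_adj_diag m (Y : 'M[C]_(n, m)) k :
  (Y *m Y^t*) k k = (\sum_j nsq (Y k j))%:C.
Proof.
rewrite mxE rmorph_sum; apply: eq_bigr => j _.
by rewrite !mxE nsq_mul_conj.
Qed.

(** Y Y^* is the sum of the rank-one matrices of the columns of Y. *)
Lemma gain_form_adj m (Y : 'M[C]_(n, m)) k :
  gain_form k (Y *m Y^t*) = (\sum_j gain (col j Y) k)%:C.
Proof.
rewrite /gain_form mulmxA -mulmxA -adjmxM !mul_adj_diag -rmorphM -rmorphB /=.
congr (_%:C); rewrite mulr_sumr -sumrB; apply: eq_bigr => j _.
by rewrite /gain colE mulmxA -!colE ![col _ _ _ _]mxE.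
Qed.

Lemma gain_form_hermitian_real k X : X^t* = X -> (complex.Re (gain_form k X))%:C = gain_form k X.
Proof.
move=> hX; apply: RRe_real; apply/CrealP.
have diagR (Z : 'M[C]_n) : Z^t* = Z -> conjC (Z k k) = Z k k.
  by move=> {2}<-; rewrite !mxE.
rewrite /gain_form rmorphB rmorphM /= conj_real diagR ?(diagR X) //.
by rewrite !adjmxM trmxCK hX mulmxA.
Qed.

Lemma gain0 k : gain 0 k = 0.
Proof. by rewrite /gain mulmx0 mxE nsq0 mulr0 subr0. Qed.

(* Moving Y Y^* along a Hermitian direction that leaves all forms unchanged,
   until it leaves the interior of the cone of psd matrices. *)
Lemma drop_column c m p (Y : 'M[C]_(n, m)) (E : 'I_p -> 'M[C]_m) : (n < p)%N ->
  entries_over c Y -> (forall i, (E i)^t* = E i) -> (forall i, entries_over c (E i)) ->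
  (forall x : 'rV[R]_p, \sum_i (x ord0 i)%:C *: E i = 0 -> x = 0) ->
  exists Z : 'M[C]_(n, m), [/\ entries_over c Z, exists j, col j Z = 0 &
    forall k, \sum_j gain (col j Z) k = \sum_j gain (col j Y) k].
Proof.
move=> np cY hE cE freeE.
(* p rows and n < p columns: some nonzero real combination of the E_i is annihilated by all n
   forms. *)
pose G : 'M[R]_(p, n) := \matrix_(i, k) complex.Re (gain_form k (Y *m E i *m Y^t*)).
have [x xG x0] : exists2 x : 'rV[R]_p, x *m G = 0 & x != 0.
  have : kermx G != 0.
    rewrite -mxrank_eq0 mxrank_ker -lt0n subn_gt0.
    by apply: leq_ltn_trans (rank_leq_col G) np.
  move/rowV0Pn=> [x /sub_kermxP xG x0]; by exists x.
pose D := \sum_i (x ord0 i)%:C *: E i.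
have D0 : D != 0 by apply: contraNneq x0 => /freeE ->.
have hD : D^t* = D.
  rewrite /D raddf_sum /= map_mx_sum; apply: eq_bigr => i _.
  by rewrite adjmxZ conj_real hE.
have cD : entries_over c D.
  apply: overP => c0; rewrite /D map_mx_sum; apply: eq_bigr => i _.
  by rewrite map_mxZ /= conj_real (over_conj (cE i)).
have gain_formYD k : gain_form k (Y *m D *m Y^t*) = 0.
  rewrite /D mulmx_sumr mulmx_suml gain_form_sum.
  transitivity (\sum_i (x ord0 i * G i k)%:C).
    apply: eq_bigr => i _; rewrite -scalemxAr -scalemxAl gain_formZ rmorphM [G i k]mxE /=.
    by rewrite gain_form_hermitian_real // !adjmxM trmxCK hE mulmxA.
  by rewrite -rmorph_sum; have /rowP/(_ k) := xG; rewrite !mxE => ->.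
have [l lR [psdM detM]] := hermitian_singular_psd hD D0.
have cM : entries_over c (1%:M - l *: D).
  by apply: overP => c0; rewrite map_mxB map_mxZ map_mx1 /= lR (over_conj cD).
have [L [cL LE Lcol]] := cholesky psdM cM.
exists (Y *m L); split; first exact: over_mulmx.
  have /Lcol[j Lj] : \det L = 0.
    move: detM; rewrite LE det_mulmx det_map_mx det_tr => /eqP.
    by rewrite mulf_eq0 conjC_eq0 orbb => /eqP.
  by exists j; rewrite colE -mulmxA -colE Lj mulmx0.
(* With Z = Y L one has Z Z^* = Y (1 - l D) Y^*, and the term in D contributes 0. *)
move=> k; apply: (@complexI R); rewrite -!gain_form_adj adjmxM mulmxA -(mulmxA Y) -LE.
rewrite mulmxBr mulmxBl mulmx1 -scaleN1r gain_formD gain_formZ.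
rewrite -scalemxAr -scalemxAl gain_formZ gain_formYD.
by rewrite !mulr0 addr0.
Qed.

End Form.
End Reduction.

(** * Merging columns in low dimension *)

Section SmallColumns.
Variables (R : realType) (n : nat) (B : 'M[R[i]]_n) (b : R).
Notation C := R[i].
Implicit Types (u v w : 'cV[C]_n).

Lemma adj_delta_mx m (i j : 'I_m) : (delta_mx i j : 'M[C]_m)^t* = delta_mx j i.
Proof. by rewrite trmx_delta map_delta_mx. Qed.

Lemma merge2 u v : (n <= 3)%N ->
  exists w, forall k, gain B b w k = gain B b u k + gain B b v k.
Proof.
move=> n3; pose Y : 'M[C]_(n, 2) := \matrix_(i, j) if j == ord0 then u i ord0 else v i ord0.
pose a0 : 'I_2 := ord0; pose a1 : 'I_2 := ord_max.
pose e i j : 'M[C]_2 := delta_mx i j.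
pose E (i : 'I_4) : 'M[C]_2 :=
  [:: e a0 a0; e a1 a1; e a0 a1 + e a1 a0; 'i *: (e a0 a1 - e a1 a0)]`_i.
have hE i : (E i)^t* = E i.
  rewrite /E; case: i => -[|[|[|[|//]]]] _ /=; rewrite ?adjmxZ ?adjmxB ?adjmxD !adj_delta_mx //.
    by rewrite addrC.
  by rewrite conjCi scaleNr -scalerN opprB.
have freeE (x : 'rV[R]_4) : \sum_i (x ord0 i)%:C *: E i = 0 -> x = 0.
  rewrite !big_ord_recl big_ord0 addr0 /= => /matrixP xE.
  have := xE a0 a0; have := xE a1 a1; have := xE a0 a1.
  rewrite !mxE /= !(mulr0, mulr1, addr0, add0r, subr0, oppr0) -complexiE.
  set p2 := x _ _; set p3 := x _ _; set p1 := x _ _; set p0 := x _ _.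
  move=> p23 p1z p0z; have [p2z p3z] : p2 = 0 /\ p3 = 0.
    by move/eqP: p23; rewrite eq_complex /=; simpc => /andP[/eqP-> /eqP->].
  apply/rowP; case; case=> [|[|[|[|//]]]] lt4; rewrite mxE.
  - by rewrite -(complexI p0z); congr (x _ _); apply: val_inj.
  - by rewrite -(complexI p1z); congr (x _ _); apply: val_inj.
  - by rewrite -p2z; congr (x _ _); apply: val_inj.
  - by rewrite -p3z; congr (x _ _); apply: val_inj.
have [Z [_ [j Zj] ZY]] := @drop_column R n B b true 2 4 Y E n3 isT hE (fun=> isT) freeE.
have sumY k : \sum_j gain B b (col j Y) k = gain B b u k + gain B b v k.
  have -> : u = col ord0 Y by apply/colP => i; rewrite !mxE.
  have -> : v = col (lift ord0 ord0) Y by apply/colP => i; rewrite !mxE.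
  by rewrite !big_ord_recl big_ord0 addr0.
exists (col (lift j ord0) Z) => k; rewrite -sumY -ZY (bigD1 j) //= Zj gain0 add0r.
rewrite (bigD1 (lift j ord0)) ?(eq_sym _ j) ?neq_lift //= big1 ?addr0 // => i.
case: (unliftP j i) => [h ->|->]; last by rewrite eqxx.
by rewrite (ord1 h) eqxx andbF.
Qed.

Lemma merge3 u v w : (n <= 5)%N ->
  entries_over false u -> entries_over false v -> entries_over false w ->
  exists x y, [/\ entries_over false x, entries_over false y &
    forall k, gain B b x k + gain B b y k = gain B b u k + gain B b v k + gain B b w k].
Proof.
move=> n5 uR vR wR.
pose a0 : 'I_3 := ord0; pose a1 : 'I_3 := lift ord0 ord0; pose a2 : 'I_3 := ord_max.
pose Y : 'M[C]_(n, 3) := \matrix_(i, j)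
  if j == a0 then u i ord0 else if j == a1 then v i ord0 else w i ord0.
pose e i j : 'M[C]_3 := delta_mx i j.
pose E (i : 'I_6) : 'M[C]_3 := [:: e a0 a0; e a1 a1; e a2 a2;
  e a0 a1 + e a1 a0; e a0 a2 + e a2 a0; e a1 a2 + e a2 a1]`_i.
have hE i : (E i)^t* = E i.
  rewrite /E; case: i => -[|[|[|[|[|[|//]]]]]] _ /=;
  by rewrite ?adjmxD !adj_delta_mx // addrC.
have cE i : entries_over false (E i).
  apply/eqP; rewrite /E; case: i => -[|[|[|[|[|[|//]]]]]] _ /=;
  by rewrite ?map_mxD !map_delta_mx.
have freeE (x : 'rV[R]_6) : \sum_i (x ord0 i)%:C *: E i = 0 -> x = 0.
  rewrite !big_ord_recl big_ord0 addr0 /= => /matrixP xE.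
  have := xE a1 a2; have := xE a0 a2; have := xE a0 a1.
  have := xE a2 a2; have := xE a1 a1; have := xE a0 a0.
  rewrite !mxE /= !(mulr0, mulr1, addr0, add0r, subr0) => x0 x1 x2 x3 x4 x5.
  apply/rowP; case; case=> [|[|[|[|[|[|//]]]]]] lt6; rewrite mxE.
  - by rewrite -(complexI x0); congr (x _ _); apply: val_inj.
  - by rewrite -(complexI x1); congr (x _ _); apply: val_inj.
  - by rewrite -(complexI x2); congr (x _ _); apply: val_inj.
  - by rewrite -(complexI x3); congr (x _ _); apply: val_inj.
  - by rewrite -(complexI x4); congr (x _ _); apply: val_inj.
  - by rewrite -(complexI x5); congr (x _ _); apply: val_inj.
have colR (t : 'cV[C]_n) i : entries_over false t -> conjC (t i ord0) = t i ord0.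
  by move=> /eqP/colP/(_ i); rewrite mxE.
have YR : entries_over false Y.
  by apply/eqP/matrixP => i j; rewrite !mxE; case: eqP => _; [|case: eqP => _]; apply: colR.
have [Z [ZR [j Zj] ZY]] := @drop_column R n B b false 3 6 Y E n5 YR hE cE freeE.
have sumY k : \sum_j gain B b (col j Y) k = gain B b u k + gain B b v k + gain B b w k.
  have -> : u = col a0 Y by apply/colP => i; rewrite !mxE.
  have -> : v = col a1 Y by apply/colP => i; rewrite !mxE.
  have -> : w = col (lift ord0 (lift ord0 ord0)) Y by apply/colP => i; rewrite !mxE.
  by rewrite !big_ord_recl big_ord0 addr0 addrA.
have ZcR i : entries_over false (col i Z).
  by apply/eqP; rewrite map_col; move/eqP: ZR => ->.
exists (col (lift j ord0) Z), (col (lift j ord_max) Z); split=> // k.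
rewrite -sumY -ZY (bigD1 j) //= Zj gain0 add0r.
rewrite (bigD1 (lift j ord0)) ?(eq_sym _ j) ?neq_lift //=.
rewrite (bigD1 (lift j ord_max)) ?(eq_sym _ j) ?neq_lift ?(inj_eq lift_inj) //=.
rewrite big1 ?addr0 // => i.
case: (unliftP j i) => [h ->|->]; last by rewrite eqxx.
rewrite !(inj_eq lift_inj); case: h => -[|[|//]] lt2 /andP[/andP[_ h0] h1].
  by case/eqP: h0; apply: val_inj.
by case/eqP: h1; apply: val_inj.
Qed.

Lemma merge_seq2 (s : seq 'cV[C]_n) : (n <= 3)%N ->
  exists w, forall k, gain B b w k = \sum_(u <- s) gain B b u k.
Proof.
move=> n3; elim: s => [|u s [w ws]].
  by exists 0 => k; rewrite big_nil gain0.
have [x xE] := merge2 u w n3.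
by exists x => k; rewrite big_cons xE ws.
Qed.

Lemma merge_seq3 (s : seq 'cV[C]_n) : (n <= 5)%N -> all (fun u => entries_over false u) s ->
  exists x y, [/\ entries_over false x, entries_over false y &
    forall k, gain B b x k + gain B b y k = \sum_(u <- s) gain B b u k].
Proof.
move=> n5; elim: s => [_|u s IHs /= /andP[uR /IHs[x [y [xR yR xys]]]]].
  have R0 : entries_over false (0 : 'cV[C]_n) by apply/eqP; rewrite map_mx0.
  by exists 0, 0; split=> // k; rewrite big_nil !gain0 addr0.
have [x' [y' [x'R y'R xyE]]] := merge3 n5 uR xR yR.
exists x', y'; split; [exact: x'R|exact: y'R|] => k.
by rewrite big_cons xyE -addrA xys.
Qed.

End SmallColumns.

(** * Separation *)

Section Separation.
Variables (R : realType) (n : nat) (B : 'M[R[i]]_n) (b : R).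
Notation C := R[i].
Implicit Types (L : 'M[C]_n) (w : 'cV[C]_n).

(** The trace of L L^*, that is, the square of the usual Frobenius norm. *)
Definition frobenius L : R := \sum_i \sum_j nsq (L i j).

Definition total_gain L k : R := \sum_j gain B b (col j L) k.

(** The squared negative parts of the coordinates of a vector add up to its squared distance to the
    nonnegative orthant. *)
Definition negpart (x : R) : R := (`|x| - x) / 2.

Lemma negpart_ge0 x : 0 <= negpart x.
Proof. by rewrite divr_ge0 // subr_ge0 ler_norm. Qed.

Lemma negpart_eq0 x : negpart x = 0 -> 0 <= x.
Proof. by rewrite /negpart => h; have := normr_ge0 x; lra. Qed.

Lemma negpart_mul x : negpart x * x = - negpart x ^+ 2.
Proof.
rewrite /negpart; case: (ger0P x) => _; by field.
Qed.

(** Expanding the right-hand side gives a first-order bound with error y^2, used in place of a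
    derivative of the squared negative part. *)
Lemma negpart_sqrD x y : negpart (x + y) ^+ 2 <= (negpart x - y) ^+ 2.
Proof.
rewrite /negpart; case: (ger0P x) => x0; case: (ger0P (x + y)) => xy0; nra.
Qed.

Lemma gainZ a w k : gain B b (a *: w) k = nsq a * gain B b w k.
Proof.
have aE (v : 'cV[C]_n) : (a *: v) k ord0 = a * v k ord0 by rewrite mxE.
by rewrite /gain -scalemxAr !aE !nsqM; ring.
Qed.

(** The sphere of factors L with trace of L L^* equal to 1 is compact, and the squared distance to
    the orthant is continuous on it. *)
Lemma min_negpart : (0 < n)%N -> exists2 L, frobenius L = 1 &
  forall M, frobenius M = 1 ->
    \sum_k negpart (total_gain L k) ^+ 2 <= \sum_k negpart (total_gain M k) ^+ 2.
Proof.
move=> n0; pose T := ('rV[R]_(n * n) * 'rV[R]_(n * n))%type.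
pose Lt (t : T) : 'M[C]_n :=
  \matrix_(i, j) (t.1 ord0 (mxvec_index i j) +i* t.2 ord0 (mxvec_index i j)).
have cL i j : ccont (fun t => Lt t i j).
  under eq_fun do rewrite mxE.
  apply: ccont_pair => t.
    apply: (@continuous_comp _ _ _ (fun t : T => t.1) (fun v => v ord0 (mxvec_index i j))).
      exact: cvg_fst.
    exact: coord_continuous.
  apply: (@continuous_comp _ _ _ (fun t : T => t.2) (fun v => v ord0 (mxvec_index i j))).
    exact: cvg_snd.
  exact: coord_continuous.
have csum (I : finType) (F : I -> T -> R) : (forall i, continuous (F i)) ->
    continuous (fun t => \sum_i F i t).
  by move=> cF; apply: continuous_big => [|i _]; [exact: add_continuous|exact: cF].
have cfrob : continuous (fun t => frobenius (Lt t)).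
  by apply: (csum _ _) => i; apply: (csum _ _) => j; apply: continuous_nsq.
have cgain k : continuous (fun t => total_gain (Lt t) k).
  apply: (csum _ _) => j t; apply: cvgB.
    have : ccont (fun t => (B *m col j (Lt t)) k ord0).
      under eq_fun do rewrite mxE.
      apply: ccont_sum => i; apply: ccontM; first exact: ccont_cst.
      by under eq_fun do rewrite mxE.
    by move/continuous_nsq; apply.
  apply: cvgM; first exact: cvg_cst.
  have : ccont (fun t => col j (Lt t) k ord0) by under eq_fun do rewrite mxE.
  by move/continuous_nsq; apply.
have cneg : continuous (fun t => \sum_k negpart (total_gain (Lt t) k) ^+ 2).
  apply: (csum _ _) => k t.
  have cn : negpart (total_gain (Lt s) k) @[s --> t] --> negpart (total_gain (Lt t) k).
    apply: cvgM; last exact: cvg_cst.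
    by apply: cvgB; [apply: cvg_norm|]; exact: cgain.
  by apply: cvgM.
pose box : set 'rV[R]_(n * n) := [set v | forall k, `[-1, 1]%classic (v ord0 k)].
have cbox : compact box.
  by apply: (@rV_compact R (n * n) (fun=> `[-1, 1]%classic)) => k; exact: segment_compact.
pose K : set T := (box `*` box) `&` [set t | frobenius (Lt t) = 1].
have cK : compact K.
  apply: compact_closedI; first exact: compact_setX.
  apply: (@preimage_closed _ _ (fun t => frobenius (Lt t)) [set 1]).
    by move=> t _; apply: cfrob.
  exact: closed_eq.
have KP M : frobenius M = 1 -> exists2 t, K t & Lt t = M.
  move=> M1.
  have leM i j : nsq (M i j) <= 1.
    rewrite -M1 /frobenius (bigD1 i) //= (bigD1 j) //= -addrA lerDl.
    by rewrite addr_ge0 // sumr_ge0 // => ? _; rewrite ?sumr_ge0 // => *; rewrite nsq_ge0.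
  have le1 (x y : R) : x ^+ 2 + y ^+ 2 <= 1 -> -1 <= x <= 1.
    by move=> xy; have := sqr_ge0 y; nra.
  pose t : T := (mxvec (map_mx (@complex.Re R) M), mxvec (map_mx (@complex.Im R) M)).
  have tM : Lt t = M.
    by apply/matrixP => i j; rewrite mxE /= !mxvecE !mxE; case: (M i j).
  exists t => //; split; last by rewrite /= tM.
  split=> k /=; case/mxvec_indexP: k => i j; rewrite mxvecE mxE in_itv /=.
    by apply: (le1 _ (complex.Im (M i j))); exact: leM.
  by apply: (le1 _ (complex.Re (M i j))); rewrite addrC; exact: leM.
have K0 : K !=set0.
  have /KP[t Kt _] : frobenius (delta_mx (Ordinal n0) (Ordinal n0)) = 1; last by exists t.
  rewrite /frobenius (bigD1 (Ordinal n0)) //= (bigD1 (Ordinal n0)) //= !big1.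
  - by rewrite mxE !eqxx nsqR expr1n !addr0.
  - by move=> i i0; apply: big1 => j _; rewrite mxE (negPf i0) nsq0.
  - by move=> j j0; rewrite mxE (negPf j0) andbF nsq0.
have [t tK tmin] := compact_EVT_min K0 cK (continuous_subspaceT cneg).
exists (Lt t); first by move: tK; rewrite inE => -[].
by move=> M /KP[s Ks <-]; apply: tmin; rewrite inE.
Qed.

(** Convexity holds for L L^* rather than for L: the mixture of L L^* and w w^* is psd of trace 1,
    and is factored again by Cholesky. *)
Lemma mix_rank_one L w (t : R) : 0 <= t <= 1 -> frobenius L = 1 -> vnsq w = 1 ->
  exists2 M, frobenius M = 1 & forall k,
    total_gain M k = (1 - t) * total_gain L k + t * gain B b w k.
Proof.
move=> /andP[t0 t1] L1 w1.
pose X := (1 - t)%:C *: (L *m L^t*) + t%:C *: (w *m w^t*).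
have psdX : psd X.
  by apply: psdD; apply: psdZ; rewrite ?lecR ?subr_ge0 //; apply: psd_mul_adj.
have [//|M [_ XE _]] := @cholesky _ true _ X psdX.
exists M.
  apply: (@complexI R); rewrite /frobenius rmorph_sum /=.
  transitivity (\sum_k X k k).
    by apply: eq_bigr => k _; rewrite XE mul_adj_diag.
  transitivity ((1 - t)%:C * (frobenius L)%:C + t%:C * (vnsq w)%:C).
    rewrite /frobenius /vnsq !rmorph_sum !mulr_sumr -big_split; apply: eq_bigr => k _ /=.
    have aE (a : C) (Z : 'M[C]_n) : (a *: Z) k k = a * Z k k by rewrite mxE.
    rewrite [X k k]mxE !aE !mul_adj_diag.
    by rewrite big_ord1.
  by rewrite L1 w1 !mulr1 -rmorphD subrK.
move=> k; apply: (@complexI R); rewrite -gain_form_adj -XE /X gain_formD !gain_formZ !gain_form_adj.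
rewrite big_ord1 [RHS]rmorphD [X in _ = X + _]rmorphM [X in _ = _ + X]rmorphM /=.
by have -> : col ord0 w = w by apply/colP => i; rewrite mxE.
Qed.

(** If the least squared distance c to the orthant were positive, the negative parts d of the
    minimizer would define a separating hyperplane: the d-weighted gain of every unit w is at most -
    c. The scaling with weights d would then have norm below b. *)
Lemma inf_scaled_norm_feasible : (0 < n)%N -> 0 <= b -> b <= inf_scaled_norm B ->
  exists2 L, frobenius L = 1 & forall k, 0 <= total_gain L k.
Proof.
move=> n0 b0 leb; have [L L1 minL] := min_negpart n0.
exists L => // k0; apply/negPn/negP => Lk0.
pose d k := negpart (total_gain L k); pose c := \sum_k d k ^+ 2.
have c0 : 0 < c.
  rewrite /c (bigD1 k0) //= ltr_pwDl ?sumr_ge0 // => [|k _]; last exact: sqr_ge0.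
  rewrite exprn_gt0 // lt_def negpart_ge0 andbT.
  by apply: contraNneq Lk0 => /negpart_eq0.
have unit_le w : vnsq w = 1 -> \sum_k d k * gain B b w k <= - c.
  move=> w1; pose q k := gain B b w k - total_gain L k.
  suff : \sum_k d k * q k <= 0.
    have -> : \sum_k d k * q k = \sum_k d k * gain B b w k - \sum_k d k * total_gain L k.
      by rewrite -sumrB; apply: eq_bigr => k _; rewrite mulrBr.
    have -> : \sum_k d k * total_gain L k = - c.
      by rewrite /c -sumrN; apply: eq_bigr => k _; rewrite negpart_mul.
    by rewrite subr_le0.
  set P := \sum_k d k * q k; pose Q := \sum_k q k ^+ 2.
  have Q0 : 0 <= Q by apply: sumr_ge0 => k _; exact: sqr_ge0.
  (* Minimality of L is tested against the mixture with weight t on w w^*. *)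
  have step t : 0 <= t <= 1 -> 0 <= - (2 * t * P) + t ^+ 2 * Q.
    move=> t01; have [M M1 ME] := mix_rank_one t01 L1 w1.
    have := minL M M1; rewrite -subr_ge0 => /le_trans; apply.
    rewrite -sumrB /P /Q !mulr_sumr -sumrN -big_split; apply: ler_sum => k _ /=.
    rewrite ME (_ : (1 - t) * _ + _ = total_gain L k + t * q k); last by rewrite /q; ring.
    rewrite lerBlDr; apply: le_trans (negpart_sqrD _ _) _.
    by rewrite -/(d k) le_eqVlt; apply/orP; left; apply/eqP; ring.
  rewrite leNgt; apply/negP => P0.
  have D0 : 0 < Q + P + 1 by lra.
  (* This t lies in (0, 1] and satisfies t Q <= P < 2 P, so the expression in [step] is negative. *)
  pose t := P / (Q + P + 1).
  have t0 : 0 < t by rewrite divr_gt0.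
  have tE : t * (Q + P + 1) = P by rewrite divfK // gt_eqF.
  have /step : 0 <= t <= 1.
    by rewrite ltW //= ler_pdivrMr // mul1r; lra.
  have -> : - (2 * t * P) + t ^+ 2 * Q = t * (t * Q - 2 * P) by ring.
  by rewrite pmulr_rge0 //; nra.
have all_le w : \sum_k d k * gain B b w k <= - (c * vnsq w).
  have [->|w0] := eqVneq w 0.
    rewrite (eqP (_ : vnsq 0 == 0)) ?vnsq_eq0 // mulr0 oppr0 big1 // => k _.
    by rewrite gain0 mulr0.
  have v0 : 0 < vnsq w by rewrite vnsq_gt0.
  pose a := (Num.sqrt (vnsq w))^-1.
  have a2 : a ^+ 2 = (vnsq w)^-1 by rewrite exprVn sqr_sqrtr ?ltW.
  have := unit_le (a%:C *: w); rewrite vnsqZ nsqR a2 mulVf ?gt_eqF // => /(_ erefl).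
  under eq_bigr do rewrite gainZ nsqR a2 mulrCA.
  by rewrite -mulr_sumr mulrC ler_pdivrMr // mulNr.
have sum_le w : \sum_k d k * nsq ((B *m w) k ord0)
     <= b ^+ 2 * (\sum_k d k * nsq (w k ord0)) - c * vnsq w.
  rewrite -lerBlDl; apply: le_trans (all_le w); rewrite mulr_sumr -sumrB.
  by apply: ler_sum => k _; rewrite le_eqVlt /gain; apply/orP; left; apply/eqP; ring.
(* On the k-th basis vector a zero weight would make a nonnegative sum at most - c. *)
have d_gt0 k : 0 < d k.
  have := sum_le (delta_mx k ord0); have -> : vnsq (delta_mx k ord0 : 'cV[C]_n) = 1.
    rewrite /vnsq (bigD1 k) //= big1 => [|j jk]; first by rewrite mxE !eqxx addr0 nsqR expr1n.
    by rewrite mxE (negPf jk) nsq0.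
  have -> : \sum_j d j * nsq ((delta_mx k ord0 : 'cV[C]_n) j ord0) = d k.
    rewrite (bigD1 k) //= big1 => [|j jk]; first by rewrite mxE !eqxx addr0 nsqR expr1n mulr1.
    by rewrite mxE (negPf jk) nsq0 mulr0.
  have s0 : 0 <= \sum_j d j * nsq ((B *m (delta_mx k ord0 : 'cV_n)) j ord0).
    by apply: sumr_ge0 => j _; rewrite mulr_ge0 ?negpart_ge0 ?nsq_ge0.
  move=> le1; rewrite lt_def negpart_ge0 andbT; apply/eqP => dk0.
  by rewrite dk0 in le1; lra.
by have := inf_scaled_norm_lt n0 b0 c0 d_gt0 sum_le; rewrite ltNge leb.
Qed.

End Separation.

(** * The vanishing gap *)

Section VanishingGap.
Variables (R : realType) (n : nat).
Notation C := R[i].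
Implicit Types (B L : 'M[C]_n) (u w : 'cV[C]_n).

(* The slack between b and the infimum keeps the merged vector away from 0. *)
Lemma inf_gap_eq0 B : (0 < n)%N ->
  (forall (b : R) L, exists w, forall k, gain B b w k = total_gain B b L k) ->
  inf_gap B = 0.
Proof.
move=> n0 merge; have [m maxm lem] := rotated_radii_max B n0.
rewrite (inf_gapE n0 maxm); apply/eqP; rewrite subr_eq0 eq_le.
rewrite inf_scaled_norm_ge_max // andbT leNgt; apply/negP => mN.
have m0 : 0 <= m by case: maxm => -[U _ <-] _; exact: spectral_radius_ge0.
set N := inf_scaled_norm B in mN *.
pose b := (m + N) / 2.
have bE : b * 2 = m + N by rewrite divfK ?pnatr_eq0.
have [mb bN] : m < b /\ b < N by split; lra.
have [L L1 L0] := inf_scaled_norm_feasible n0 (ltW (le_lt_trans m0 mN)) (lexx N).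
have [w wL] := merge b L.
pose r k := \sum_j nsq (L k j).
have gainE k : gain B b w k = total_gain B N L k + (N ^+ 2 - b ^+ 2) * r k.
  rewrite wL /r mulr_sumr -big_split; apply: eq_bigr => j _ /=.
  by rewrite /gain ![col _ _ k _]mxE; ring.
have r0 k : 0 <= r k by apply: sumr_ge0 => j _; exact: nsq_ge0.
have Nb : 0 < N ^+ 2 - b ^+ 2 by rewrite subr_sqr mulr_gt0 ?subr_gt0 //; lra.
have w0 : w != 0.
  (* If w = 0, the two nonnegative terms of [gainE] vanish, so every row of L is zero, against trace
     1. *)
  apply/eqP => w0; have : frobenius L = 0.
    apply: big1 => k _; rewrite -/(r k); have := gainE k; rewrite w0 gain0.
    by move=> gk; have := L0 k; have := r0 k; nra.
  by rewrite L1 => /eqP; rewrite oner_eq0.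
have : b <= m.
  apply: (lem b w) => //; first lra.
  move=> k; rewrite -subr_ge0 -/(gain B b w k) gainE addr_ge0 //.
  by rewrite mulr_ge0 // ltW.
by rewrite leNgt mb.
Qed.

Lemma inf_gap_complex B : (1 <= n <= 3)%N -> inf_gap B = 0.
Proof.
case/andP=> n0 n3; apply: inf_gap_eq0 => // b L.
have [w ws] := merge_seq2 B b [seq col j L | j <- enum 'I_n] n3.
by exists w => k; rewrite ws big_map big_enum.
Qed.

(** For real s and t, |s + i t|^2 = s^2 + t^2; as B is real, this applies to the entries of both v
    and B v. *)
Lemma gain_real (B0 : 'M[R]_n) (b : R) (x y : 'cV[R]_n) k (B := map_mx (real_complex R) B0) :
  gain B b (map_mx (real_complex R) x + 'i%C *: map_mx (real_complex R) y) k =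
  gain B b (map_mx (real_complex R) x) k + gain B b (map_mx (real_complex R) y) k.
Proof.
have nsqRI (s t : R) : nsq (s%:C + 'i%C * t%:C) = nsq s%:C + nsq t%:C.
  by rewrite !nsqR; simpc; rewrite /nsq /=; ring.
rewrite /gain mulmxDr -scalemxAr -!map_mxM !mxE !nsqRI; ring.
Qed.

Lemma inf_gap_real (B0 : 'M[R]_n) : (1 <= n <= 5)%N -> inf_gap (map_mx (real_complex R) B0) = 0.
Proof.
case/andP=> n0 n5; apply: inf_gap_eq0 => // b L.
set B := map_mx _ B0.
pose toC (x : 'cV[R]_n) := map_mx (real_complex R) x.
pose re u : 'cV[R]_n := map_mx (@complex.Re R) u.
pose im u : 'cV[R]_n := map_mx (@complex.Im R) u.
have decomp u : u = toC (re u) + 'i%C *: toC (im u).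
  by apply/colP => i; rewrite !mxE -complexE.
have toCR x : entries_over false (toC x).
  by apply/eqP/matrixP => i j; rewrite !mxE conj_real.
have toCP u : entries_over false u -> u = toC (re u).
  move=> /eqP/colP uR; apply/colP => i; have := uR i; rewrite !mxE => uc.
  by rewrite RRe_real //; apply/CrealP.
(* By [gain_real], splitting each column of L into its real and imaginary parts preserves the total
   gains and yields real columns. *)
pose s := [seq toC (re (col j L)) | j <- enum 'I_n] ++ [seq toC (im (col j L)) | j <- enum 'I_n].
have [|x [y [xR yR xyE]]] := @merge_seq3 R n B b s n5.
  by rewrite all_cat !all_map; apply/andP; split; apply/allP => j _; exact: toCR.
move: (toCP _ xR) (toCP _ yR) xyE => -> -> xyE.
exists (toC (re x) + 'i%C *: toC (re y)) => k; rewrite gain_real xyE.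
rewrite big_cat /= [X in X + _]big_map [X in _ + X]big_map !big_enum -big_split.
apply: eq_bigr => j _ /=.
by rewrite [in RHS](decomp (col j L)) gain_real.
Qed.

End VanishingGap.

(** * A positive gap in dimension at least four *)

Section Counterexample.
Variable R : realType.
Notation C := R[i].

(* 0, 1, i and -1-i, padded with zeros: the vectors 1 and conj x are orthogonal
   of norm 2, and B = (x 1^T - 1 x^T) / 4 maps them to x and -1. *)
Definition node (k : nat) : C := [:: 0; 1; 'i%C; -1 - 'i%C]`_k.

Definition gap_matrix n : 'M[C]_n :=
  \matrix_(k, l) if (k < 4)%N && (l < 4)%N then (node k - node l) / 4 else 0.

(** B has rank at most two: B w depends on w only through the sum of the w_l and that of the x_l
    w_l, over the first four indices. *)
Lemma gap_matrixE n (w : 'cV[C]_n.+4) (k : 'I_n.+4) :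
  (gap_matrix n.+4 *m w) k ord0 = if (k < 4)%N then
    (node k * (\sum_(l < 4) w (inord l) ord0) - \sum_(l < 4) node l * w (inord l) ord0) / 4
  else 0.
Proof.
rewrite mxE; case: ltnP => k4; last first.
  by apply: big1 => l _; rewrite mxE ltnNge k4 mul0r.
rewrite (bigID (fun l : 'I_n.+4 => (l < 4)%N)) /= [X in _ + X]big1 ?addr0; last first.
  by move=> l l4; rewrite mxE (negPf l4) andbF mul0r.
rewrite mulr_sumr -sumrB mulr_suml.
rewrite (reindex_onto (fun l : 'I_4 => inord l : 'I_n.+4) (fun l : 'I_n.+4 => inord l)) /=.
  apply: eq_big => [l|l _].
    by rewrite inordK ?inord_val ?eqxx ?ltn_ord // (leq_trans (ltn_ord l)).
  rewrite mxE inordK ?(leq_trans (ltn_ord l)) // k4 /=.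
  by rewrite -mulrBl mulrAC.
by move=> l l4; apply: val_inj; rewrite /= !inordK // ltn_ord.
Qed.

(** The last two equalities say that the real and imaginary parts of a conj(c) vanish; since |a| =
    |c|, both numbers are 0. *)
Lemma nsq_pairs_eq0 (a c : C) : nsq a = nsq c -> nsq (a + c) = nsq (a - c) ->
  nsq (a - 'i%C * c) = nsq ('i%C * a - c) -> a = 0 /\ c = 0.
Proof.
case: a c => [a1 a2] [c1 c2]; rewrite /nsq; simpc => /= e0 e1 e2.
have dot : a1 * c1 + a2 * c2 = 0 by nra.
have cross : a1 * c2 - a2 * c1 = 0 by nra.
have : (a1 ^+ 2 + a2 ^+ 2) ^+ 2 = 0.
  transitivity ((a1 * c1 + a2 * c2) ^+ 2 + (a1 * c2 - a2 * c1) ^+ 2).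
    by rewrite expr2 {2}e0; ring.
  by rewrite dot cross expr0n addr0.
move/eqP; rewrite sqrf_eq0 => /eqP az.
have [-> ->] : a1 = 0 /\ a2 = 0 by split; nra.
by have [-> ->] : c1 = 0 /\ c2 = 0 by split; nra.
Qed.

(* Bessel's inequality for the orthogonal vectors 1 and conj x is an equality
   here, so w is the corresponding combination of them. *)
Lemma nodes_eq0 (w0 w1 w2 w3 : C) (a := w0 + w1 + w2 + w3)
    (c := w1 + 'i%C * w2 + (-1 - 'i%C) * w3) :
  16 * nsq w0 <= nsq (- c) -> 16 * nsq w1 <= nsq (a - c) ->
  16 * nsq w2 <= nsq ('i%C * a - c) ->
  16 * nsq w3 <= nsq ((-1 - 'i%C) * a - c) -> a = 0 /\ c = 0.
Proof.
have nsq4 z : 16 * nsq z = nsq ((4 : R)%:C * z) by rewrite nsqM nsqR; ring.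
rewrite !nsq4.
set v0 := _ * w0; set v1 := _ * w1; set v2 := _ * w2; set v3 := _ * w3 => l0 l1 l2 l3.
(* The subtracted terms are the entries of a 1 + c conj x, the projection of v = 4 w onto the span
   of 1 and conj x. It has the same norm as a x - c 1 because x is orthogonal to 1, so this is the
   Pythagorean identity. *)
have bessel : nsq (v0 - a) + nsq (v1 - (a + c)) + nsq (v2 - (a - 'i%C * c)) +
    nsq (v3 - (a + (-1 + 'i%C) * c)) + (nsq (- c) + nsq (a - c) +
    nsq ('i%C * a - c) + nsq ((-1 - 'i%C) * a - c)) = nsq v0 + nsq v1 + nsq v2 + nsq v3.
  rewrite /v0 /v1 /v2 /v3 /c /a {l0 l1 l2 l3 v0 v1 v2 v3 a c}.
  case: w0 w1 w2 w3 => [p0 q0] [p1 q1] [p2 q2] [p3 q3].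
  by rewrite /nsq /=; ring.
move: (a) (c) (v0) (v1) (v2) (v3) l0 l1 l2 l3 bessel => {}a {}c u0 u1 u2 u3 l0 l1 l2 l3 bessel.
have := nsq_ge0 (u0 - a); have := nsq_ge0 (u1 - (a + c)).
have := nsq_ge0 (u2 - (a - 'i%C * c)); have := nsq_ge0 (u3 - (a + (-1 + 'i%C) * c)).
move=> n3 n2 n1 n0.
(* Summing the four hypotheses bounds the total defect by 0, so each defect vanishes and each
   hypothesis is an equality. *)
have u0E : u0 = a by apply/eqP; rewrite -subr_eq0 -nsq_eq0; apply/eqP; lra.
have u1E : u1 = a + c by apply/eqP; rewrite -subr_eq0 -nsq_eq0; apply/eqP; lra.
have u2E : u2 = a - 'i%C * c by apply/eqP; rewrite -subr_eq0 -nsq_eq0; apply/eqP; lra.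
by apply: nsq_pairs_eq0; [rewrite -u0E -(nsqN c)|rewrite -u1E|rewrite -u2E]; lra.
Qed.

(** If m >= 1, an eigenvector w of U B for an eigenvalue of modulus m has |w_k| <= |(B w)_k| for all
    k. By [nodes_eq0] both sums defining B w vanish, so B w = 0 and w = 0. *)
Lemma gap_matrix_max_lt1 n m : is_max (rotated_radii (gap_matrix n.+4)) m -> m < 1.
Proof.
move=> [[U Uu <-] _]; rewrite ltNge; apply/negP => m1.
have [l /eigenvalue_colP[w w0 UBw] lm] := spectral_radius_attained (U *m gap_matrix n.+4) isT.
set B := gap_matrix n.+4 in UBw.
have lew k : nsq (w k ord0) <= nsq ((B *m w) k ord0).
  have -> : nsq ((B *m w) k ord0) = nsq l * nsq (w k ord0).
    have : U k k * (B *m w) k ord0 = l * w k ord0.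
      by rewrite -is_diag_mulmxE ?Uu.1 // mulmxA UBw mxE.
    by move/(congr1 (@nsq R)); rewrite !nsqM -(normc_sqr (U k k)) Uu.2 expr1n mul1r.
  by rewrite ler_peMl ?nsq_ge0 // -normc_sqr lm exprn_ege1.
have [az cz] : \sum_(i < 4) w (inord i) ord0 = 0 /\ \sum_(i < 4) node i * w (inord i) ord0 = 0.
  have lew4 i : (i < 4)%N -> _ := fun _ => lew (inord i).
  have := (lew4 0 isT, lew4 1 isT, lew4 2 isT, lew4 3 isT).
  have nsq16 z y : nsq z <= nsq (y / 4) -> 16 * nsq z <= nsq y.
    by rewrite nsqM nsqV [X in _ / X](_ : _ = 16); [move=> h; lra|rewrite /nsq /=; ring].
  rewrite /B !gap_matrixE !inordK //=.
  rewrite !big_ord_recl !big_ord0 /node /= !(mul0r, mul1r, addr0, add0r, sub0r) !addrA.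
  by move=> [[[/nsq16 l0 /nsq16 l1] /nsq16 l2] /nsq16 l3]; apply: nodes_eq0.
case/eqP: w0; apply/colP => k; rewrite mxE; apply/eqP; rewrite -nsq_eq0 eq_le nsq_ge0 andbT.
by rewrite (le_trans (lew k)) // /B gap_matrixE az cz mulr0 subrr mul0r if_same nsq0.
Qed.

(** B maps e to x and y = conj x to - e, while |S y| = |S x| because S is diagonal. Hence |S e| <= N
    |S x| <= N^2 |S e|. *)
Lemma gap_matrix_norm_ge1 n : 1 <= inf_scaled_norm (gap_matrix n.+4).
Proof.
apply: inf_scaled_norm_ge => S Sp; set B := gap_matrix _; set N := opnorm _.
pose e : 'cV[C]_n.+4 := \col_k (k < 4)%N%:R.
pose x : 'cV[C]_n.+4 := \col_k if (k < 4)%N then node k else 0.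
pose y : 'cV[C]_n.+4 := map_mx conjC x.
have Be : B *m e = x.
  apply/colP => k; rewrite gap_matrixE mxE; case: ifP => // k4.
  rewrite !big_ord_recl !big_ord0 !mxE !inordK //= /node /=.
  by field.
have By : B *m y = - e.
  apply/colP => k; rewrite gap_matrixE !mxE; case: ifP => k4; last by rewrite oppr0.
  rewrite !big_ord_recl !big_ord0 !mxE !inordK //=.
  rewrite !nsq_mul_conj !addr0 -!rmorphD /= -/(node 0).
  have -> : node 0 + (node 1 + (node 2 + node 3)) = 0 by rewrite /node /=; ring.
  rewrite rmorph0 mulr0 sub0r.
  have -> : nsq (node 0) + (nsq (node 1) + (nsq (node 2) + nsq (node 3))) = 4.
    rewrite /node /nsq /=; ring.
  by rewrite rmorph_nat mulNr divff ?pnatr_eq0.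
have leN u : vnsq (S *m (B *m u)) <= N ^+ 2 * vnsq (S *m u).
  have := vnsq_mulmx_le (S *m B *m invmx S) (S *m u).
  by rewrite [X in vnsq X <= _ -> _]mulmxA mulmxKV ?pos_diag_unit // -mulmxA.
have yx : vnsq (S *m y) = vnsq (S *m x).
  apply: eq_bigr => k _; rewrite !is_diag_mulmxE ?Sp.1 // !nsqM [y k ord0]mxE.
  by congr (_ * _); case: (x k ord0) => r s; rewrite /nsq /= sqrrN.
have ne : vnsq (S *m - e) = vnsq (S *m e).
  by rewrite mulmxN; apply: eq_bigr => k _; rewrite mxE nsqN.
have := leN e; have := leN y; rewrite Be By yx ne => le1 le2.
have e_gt0 : 0 < vnsq (S *m e).
  rewrite vnsq_gt0; apply: contraTneq isT => Se0.
  have : e = 0 by rewrite -[e](mulKmx (pos_diag_unit Sp)) Se0 mulmx0.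
  by move/colP/(_ ord0)/eqP; rewrite !mxE /= oner_eq0.
rewrite leNgt; apply/negP => N1.
have N0 : 0 <= N by exact: opnorm_ge0.
have N2 : N ^+ 2 < 1 by rewrite expr_lt1.
have lt_e : N ^+ 2 * vnsq (S *m e) < vnsq (S *m e) by rewrite gtr_pMl.
have le_x : N ^+ 2 * vnsq (S *m x) <= vnsq (S *m x) by rewrite ler_piMl ?vnsq_ge0 // ltW.
by have := le_lt_trans (le_trans le1 (le_trans le_x le2)) lt_e; rewrite ltxx.
Qed.

End Counterexample.

Theorem lemma2p1 (R : realType) :
  (* (1) *)
  (forall (n : nat) (B : 'M[R[i]]_n), (1 <= n)%N ->
     (forall S U : 'M[R[i]]_n, pos_diag S -> unimod_diag U ->
        [/\ spectral_radius (U *m B)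
              = spectral_radius (S *m U *m B *m invmx S),
            spectral_radius (S *m U *m B *m invmx S)
              <= opnorm (S *m U *m B *m invmx S)
          & opnorm (S *m U *m B *m invmx S) = opnorm (S *m B *m invmx S)])
     /\
     (exists2 m : R, is_max (rotated_radii B) m
        & inf_gap B = inf_scaled_norm B - m))
  /\
  (* (2) *)
  ((forall (n : nat) (B : 'M[R[i]]_n), (1 <= n <= 3)%N -> inf_gap B = 0)
   /\
   (forall (n : nat) (B : 'M[R]_n), (1 <= n <= 5)%N ->
      inf_gap (map_mx (real_complex R) B) = 0))
  /\
  (* (3) *)
  (forall n : nat, (4 <= n)%N ->
     exists B : 'M[R[i]]_n,
       exists2 m : R, is_max (rotated_radii B) m & m < inf_scaled_norm B).
Proof.
split; [|split; [split|]].
- move=> n B n0; split.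
    move=> S U Sp Uu; split; first by rewrite spectral_radius_scaled.
      exact: spectral_radius_le_opnorm.
    exact: opnorm_unimod.
  have [m maxm _] := rotated_radii_max B n0.
  by exists m => //; apply: inf_gapE.
- by move=> n B; apply: inf_gap_complex.
- by move=> n B; apply: inf_gap_real.
- case=> [|[|[|[|n]]]] // _.
  have [m maxm _] := rotated_radii_max (gap_matrix R n.+4) isT.
  exists (gap_matrix R n.+4), m => //.
  exact: lt_le_trans (gap_matrix_max_lt1 maxm) (gap_matrix_norm_ge1 R n).
Qed.
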